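(* Let $4\le p\le n-1$, let $\langle R,S,T\rangle$ be a partition of $V$ (some parts possibly empty) with $0,n\in S$. The generalized max-cut inequality $$x((S:T))+\sum_{i\in R}x(\delta^+(i))\le \left\lfloor \tfrac{p+|R|}{2}\right\rfloor$$ is valid for $P^p_{0,n}(D)$, and it is facet defining for $P^p_{0,n}(D)$ if and only if $p+|R|$ is odd, $|S\setminus\{n\}|>(p-|R|)/2$, $|T|>(p-|R|)/2$, and either (i) $p=|R|+3$, $|R|\ge 2$ and $|S|=3$, or (ii) $p\ge |R|+5$.
   Context: Let $n$ be a positive integer, $V=\{0,1,\dots,n\}$, and let $D=(V,A)$ be the digraph whose arc set $A$ consists of all ordered pairs $(i,j)$ with $i\neq j$, $i,j\in V$, except that no arc enters node $0$, no arc leaves node $n$, and the arc $(0,n)$ is absent. A $(0,n)$-$p$-path is a simple directed path in $D$ from $0$ to $n$ with exactly $p$ arcs. $P^p_{0,n}(D)\subseteq\mathbb{R}^A$ is the convex hull of the incidence vectors of all $(0,n)$-$p$-paths. For $F\subseteq A$, $x(F)=\sum_{(i,j)\in F}x_{ij}$; $\delta^+(k)$ is the set of arcs of $A$ leaving node $k$. For node sets $S,T$, $(S:T)=\{(i,j)\in A: i\in S, j\in T\}$. Facet defining means valid and defining a face of dimension $\dim P^p_{0,n}(D)-1$. *)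

(* Defs.v *)
From HB Require Import structures.
From mathcomp Require Import all_boot all_order all_algebra.
Set Implicit Arguments. Unset Strict Implicit. Unset Printing Implicit Defensive.
Import Order.TTheory GRing.Theory Num.Theory.
Local Open Scope ring_scope.

(* Nodes V = {0,...,n} are 'I_n.+1; node 0 is ord0, node n is ord_max. *)

Definition arcb (n : nat) (a : 'I_n.+1 * 'I_n.+1) : bool :=
  [&& a.1 != a.2, a.2 != ord0, a.1 != ord_max & ~~ ((a.1 == ord0) && (a.2 == ord_max))].

Arguments arcb : clear implicits.

Definition arc (n : nat) := {a : 'I_n.+1 * 'I_n.+1 | arcb n a}.

Definition tl n (a : arc n) : 'I_n.+1 := (val a).1.
Definition hd n (a : arc n) : 'I_n.+1 := (val a).2.

Notation vec R n := (arc n -> R) (only parsing).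

(* A (0,n)-p-path is given by the node sequence 0 :: t (t = nodes after 0):
   simple (uniq), consecutive pairs are arcs, ends at n, exactly p arcs. *)
Definition ppath (n p : nat) (t : seq 'I_n.+1) : bool :=
  [&& size t == p, uniq (ord0 :: t),
      path (fun i j => arcb n (i, j)) ord0 t & last ord0 t == ord_max].

Definition incid (R : realFieldType) (n : nat) (t : seq 'I_n.+1) : vec R n :=
  fun a => if val a \in zip (ord0 :: t) t then 1 else 0.

Arguments incid : clear implicits.
Arguments ppath : clear implicits.

Definition conv (R : realFieldType) n (X : vec R n -> Prop) (x : vec R n) : Prop :=
  exists m (v : 'I_m -> vec R n) (l : 'I_m -> R),
    [/\ forall i, X (v i), forall i, 0 <= l i, \sum_i l i = 1
      & forall a, x a = \sum_i l i * v i a].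

Definition Ppath (R : realFieldType) (n p : nat) : vec R n -> Prop :=
  conv (fun v => exists t, ppath n p t /\ v = incid R n t).

Definition aff_indep (R : realFieldType) n k (f : 'I_k -> vec R n) : Prop :=
  forall c : 'I_k -> R, \sum_i c i = 0 -> (forall a, \sum_i c i * f i a = 0) -> forall i, c i = 0.

Definition affdim_ge (R : realFieldType) n (X : vec R n -> Prop) (k : nat) : Prop :=
  exists f : 'I_k.+1 -> vec R n, (forall i, X (f i)) /\ aff_indep f.

Definition is_affdim (R : realFieldType) n (X : vec R n -> Prop) (d : int) : Prop :=
  (d = -1 /\ forall x, ~ X x) \/
  (exists k : nat, [/\ d = k%:Z, affdim_ge X k & ~ affdim_ge X k.+1]).

Definition valid_ineq (R : realFieldType) n (P : vec R n -> Prop)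
  (phi : vec R n -> R) (b : R) : Prop := forall x, P x -> phi x <= b.

Definition facet_defining (R : realFieldType) n (P : vec R n -> Prop)
  (phi : vec R n -> R) (b : R) : Prop :=
  valid_ineq P phi b /\
  exists d : int, is_affdim P d /\ is_affdim (fun x => P x /\ phi x = b) (d - 1).

Definition gmc_lhs (R : realFieldType) n (Rs Ss Ts : {set 'I_n.+1}) (x : vec R n) : R :=
  \sum_(a : arc n | (tl a \in Ss) && (hd a \in Ts)) x a
  + \sum_(i in Rs) \sum_(a : arc n | tl a == i) x a.

Arguments Ppath : clear implicits.

(* Main.v *)
From HB Require Import structures.
From mathcomp Require Import all_boot all_order all_algebra.
From mathcomp Require Import zify lra.
Require Import Defs.
Import Order.TTheory GRing.Theory Num.Theory.
Local Open Scope ring_scope.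
Set Implicit Arguments. Unset Strict Implicit. Unset Printing Implicit Defensive.

(* Write a, d for the number of R-nodes of a path and for the number of its "bad" arcs, those
   leaving S without entering T or entering T without leaving S. Then p + a = 2 g + d, where g
   is the left-hand side; validity follows from a <= |R|, and when p + |R| is odd the path is
   tight iff (|R| - a) + d = 1.

   As all coordinates of a path sum to p, affine dimension is matrix rank minus one, and the
   inequality defines a facet iff every linear form vanishing on the tight paths is, on all
   paths, a multiple of the slack.

   Necessity: in all failing cases but one some arc lies on no tight path, although it lies on
   a path and some non-tight path avoids it. The exception is p = 4, |R| = 1, |S| = 3, where
   x_0v + x_wn - x_vw vanishes on the tight paths (R = {v}, S = {0, w, n}).

   Sufficiency: subtracting u_i - u_j + mu + lam g_ij from a linear form that is constant on
   the tight paths, one may assume that it vanishes on certain arcs. Comparing tight paths that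
   differ in a short initial fragment only, with a common completion by S-T pairs and the
   remaining R-nodes, gives linear relations which force all arcs to have weight zero. *)

(** * Facets and rank *)

Section LinearForms.
Variables (F : realFieldType) (n : nat).
Implicit Types (x : vec F n) (c : arc n -> F).

Definition dot c x : F := \sum_a c a * x a.

Definition rowv x : 'rV[F]_#|{: arc n}| := \row_j x (enum_val j).

Definition vecs_mx q (Q : 'I_q -> vec F n) := \matrix_(i < q) rowv (Q i).

Lemma rowv_mul x (c : 'cV[F]_#|{: arc n}|) :
  rowv x *m c = (dot (fun a => c (enum_rank a) 0) x)%:M.
Proof.
apply/matrixP => i j; rewrite !ord1 !mxE eqxx mulr1n /dot.
rewrite [RHS](big_enum_val (A := {: arc n})) /=; apply: eq_bigr => k _.
by rewrite mxE enum_valK mulrC.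
Qed.

Lemma rowv_eq0 x : rowv x = 0 -> forall a, x a = 0.
Proof.
by move=> /rowP x0 a; have := x0 (enum_rank a); rewrite !mxE enum_rankK.
Qed.

Lemma mulmx_vecs q (Q : 'I_q -> vec F n) (u : 'rV_q) :
  u *m vecs_mx Q = rowv (fun a => \sum_i u 0 i * Q i a).
Proof.
by apply/rowP => j; rewrite !mxE; apply: eq_bigr => i _; rewrite !mxE.
Qed.

Section AffineDimension.
Variables (X : vec F n -> Prop) (q : nat) (Q : 'I_q -> vec F n) (k0 : F).
Hypothesis k0_neq0 : k0 != 0.
Hypothesis sumX : forall x, X x -> \sum_a x a = k0.
Hypothesis QX : forall i, X (Q i).
Hypothesis spanX : forall x, X x -> (rowv x <= vecs_mx Q)%MS.

(* As [X] lies in a hyperplane missing the origin, affine independence in [X] is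
   linear independence. *)
Lemma affdim_geE k : affdim_ge X k <-> (k < \rank (vecs_mx Q))%N.
Proof.
split=> [[f [fX find]]|k_lt].
  have fsub : (vecs_mx f <= vecs_mx Q)%MS.
    by apply/row_subP => i; rewrite rowK; exact/spanX/fX.
  have ffree : row_free (vecs_mx f).
    apply: inj_row_free => u; rewrite mulmx_vecs => /rowv_eq0 u0.
    apply/rowP => i; rewrite mxE; apply: (find (fun i => u 0 i)) => //.
    (* Summing the coordinates of a vanishing linear combination gives [k0] times the sum of the
       coefficients. As [k0] is nonzero, the coefficients sum to zero and affine independence
       applies. *)
    have /eqP : \sum_a \sum_i u 0 i * f i a = 0 by apply: big1 => a _.
    rewrite exchange_big /= (eq_bigr (fun i => u 0 i * k0)).
      by rewrite -mulr_suml mulf_eq0 (negPf k0_neq0) orbF => /eqP.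
    by move=> j _; rewrite -mulr_sumr sumX.
  by rewrite -(eqP ffree) mxrankS.
(* The required points are the first k+1 members of a row basis of [vecs_mx Q]; [u] holds the
   coefficients on that basis, padded by zeros. *)
pose w := @widen_ord _ _ k_lt.
exists (fun i => Q (maxrankfun (vecs_mx Q) (w i))); split=> // c _ c0 i.
pose u : 'rV[F]_(\rank (vecs_mx Q)) := \sum_i c i *: delta_mx 0 (w i).
have uE j : u 0 (w j) = c j.
  rewrite summxE (bigD1 j) //= big1 ?addr0 ?mxE ?eqxx ?mulr1 // => l l_neq.
  rewrite !mxE eqxx /= -val_eqE /= val_eqE eq_sym (negPf l_neq).
  by rewrite mulr0.
suff u0 : u = 0 by rewrite -uE u0 mxE.
apply: (row_free_inj (maxrowsub_free (vecs_mx Q))); rewrite mul0mx mulmx_suml.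
apply/rowP => a; rewrite summxE !mxE -[RHS](c0 (enum_val a)).
apply: eq_bigr => l _; rewrite -scalemxAl -rowE mxE row_rowsub rowK.
by rewrite !mxE.
Qed.

(** The convention that the empty set has dimension -1 fits the formula: a matrix of rank zero
    leaves only the zero vector, whose coordinates do not sum to [k0]. *)
Lemma is_affdimE d : is_affdim X d <-> d = (\rank (vecs_mx Q))%:Z - 1.
Proof.
have emptyE : (forall x, ~ X x) <-> \rank (vecs_mx Q) = 0%N.
  split=> [X0|rk0 x Xx].
    apply/eqP; case: (posnP (\rank (vecs_mx Q))) => [//|/affdim_geE[f [fX _]]].
    by case: (X0 (f ord0)).
  have /eqP Q0 : vecs_mx Q == 0 by rewrite -mxrank_eq0 rk0.
  have := spanX Xx; rewrite Q0 => /submx0null/rowv_eq0 x0; move: k0_neq0.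
  by rewrite -(sumX Xx) big1 ?eqxx.
split.
  case=> [[-> /emptyE ->]//|[k [-> /affdim_geE k_lt k_ge]]].
  have rk_le : (\rank (vecs_mx Q) <= k.+1)%N.
    by rewrite leqNgt; apply/negP => /affdim_geE.
  have -> : \rank (vecs_mx Q) = k.+1 by apply/eqP; rewrite eqn_leq k_lt rk_le.
  by rewrite -addn1 PoszD addrK.
move=> ->; case E : (\rank (vecs_mx Q)) => [|k].
  by left; split=> //; apply/emptyE.
right; exists k; split; first by rewrite -addn1 PoszD addrK.
  by apply/affdim_geE; rewrite E.
by move/affdim_geE; rewrite E ltnn.
Qed.

End AffineDimension.

End LinearForms.

Section FacetCriterion.
Variables (F : realFieldType) (n p : nat) (g : arc n -> F) (b : F).
Hypothesis p_gt0 : (0 < p)%N.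
Hypothesis sum_incid : forall t, ppath n p t -> \sum_a incid F n t a = p%:R.
Hypothesis g_le_b : forall t, ppath n p t -> dot g (incid F n t) <= b.

Let tight t := dot g (incid F n t) == b.
(** Packing paths as [p]-tuples yields a finite type, so that its enumeration can index the rows of
    a matrix. *)
Let ptup (K : pred (seq 'I_n.+1)) := {t : p.-tuple 'I_n.+1 | ppath n p t && K t}.
Let Q (K : pred (seq 'I_n.+1)) (i : 'I_#|{: ptup K}|) : vec F n :=
  incid F n (val (val (enum_val i))).

Let span_incid (K : pred (seq _)) t : ppath n p t -> K t ->
  (rowv (incid F n t) <= vecs_mx (Q (K := K)))%MS.
Proof.
move=> tP Kt; have sz_t : size t == p by case/and4P: tP.
have tK : ppath n p (Tuple sz_t) && K (Tuple sz_t) by rewrite tP.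
have -> : rowv (incid F n t) = row (enum_rank (exist _ (Tuple sz_t) tK : ptup K)) (vecs_mx (Q (K := K))).
  by rewrite rowK /Q enum_rankK.
exact: row_sub.
Qed.

Let PpathP x : Ppath F n p x ->
  exists m (v : 'I_m -> seq 'I_n.+1) (l : 'I_m -> F),
  [/\ forall i, ppath n p (v i), forall i, 0 <= l i, \sum_i l i = 1
    & forall c, dot c x = \sum_i l i * dot c (incid F n (v i))] /\
    rowv x = \sum_i l i *: rowv (incid F n (v i)).
Proof.
case=> m [v [l [vP l_ge0 l1 xE]]].
have /fin_all_exists [w wP] : forall i, exists t, ppath n p t /\ v i = incid F n t.
  exact: vP.
exists m, w, l; split; first split=> //.
- by move=> i; case: (wP i).
- move=> c; rewrite /dot.
  under eq_bigr do rewrite xE mulr_sumr.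
  rewrite exchange_big; apply: eq_bigr => i _; rewrite mulr_sumr.
  by apply: eq_bigr => a _; case: (wP i) => _ ->; rewrite mulrCA.
apply/rowP => j; rewrite summxE mxE xE; apply: eq_bigr => i _.
by rewrite !mxE; case: (wP i) => _ ->.
Qed.

Let Ppath_sum x : Ppath F n p x -> \sum_a x a = p%:R.
Proof.
move=> /PpathP [m [v [l [[vP l_ge0 l1 xE] _]]]].
have dot1 y : dot (fun=> 1) y = \sum_a y a :> F.
  by apply: eq_bigr => a _; rewrite mul1r.
rewrite -dot1 xE -[RHS]mul1r -[X in X * _]l1 mulr_suml; apply: eq_bigr => i _.
by rewrite dot1 (sum_incid (vP i)).
Qed.

Let Ppath_incid t : ppath n p t -> Ppath F n p (incid F n t).
Proof.
move=> tP; exists 1%N, (fun=> incid F n t), (fun=> 1); split.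
- by move=> _; exists t.
- by [].
- by rewrite big_ord1.
- by move=> a; rewrite big_ord1 mul1r.
Qed.

Lemma Ppath_valid : valid_ineq (Ppath F n p) (dot g) b.
Proof.
move=> x /PpathP [m [v [l [[vP l_ge0 l1 ->] _]]]].
rewrite -[leRHS]mul1r -[X in _ <= X * _]l1 mulr_suml; apply: ler_sum => i _.
by apply: ler_wpM2l => //; exact: g_le_b.
Qed.

(** In a convex combination that attains [b], the weighted slacks are nonnegative and sum to zero,
    so only tight paths carry weight. *)
Let face_span x : Ppath F n p x /\ dot g x = b ->
  (rowv x <= vecs_mx (Q (K := tight)))%MS.
Proof.
case=> /PpathP [m [v [l [[vP l_ge0 l1 xE] ->]]]] gx.
apply: summx_sub => i _; case: (boolP (tight (v i))) => [ti|nti].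
  by apply: scalemx_sub; exact: span_incid.
suff -> : l i = 0 by rewrite scale0r sub0mx.
have /eqP : \sum_i l i * (b - dot g (incid F n (v i))) = 0.
  under eq_bigr do rewrite mulrBr.
  by rewrite sumrB -mulr_suml l1 mul1r -xE gx subrr.
rewrite psumr_eq0 => [/allP/(_ i)|j _]; last first.
  by rewrite mulr_ge0 // subr_ge0 g_le_b.
rewrite mem_index_enum mulf_eq0 subr_eq0 => /(_ isT) /orP[/eqP //|].
by rewrite eq_sym => /eqP E; rewrite /tight E eqxx in nti.
Qed.

(** The polytope and the face both lie in the hyperplane of coordinate sum [p], so a drop of one in
    dimension is a drop of one in rank. *)
Let facet_rank : facet_defining (Ppath F n p) (dot g) b <->
  (\rank (vecs_mx (Q (K := tight)))).+1 = \rank (vecs_mx (Q (K := predT))).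
Proof.
have p_neq0 : p%:R != 0 :> F by rewrite pnatr_eq0 -lt0n.
have QP (K : pred (seq _)) (i : 'I_#|{: ptup K}|) : Ppath F n p (Q i).
  by apply: Ppath_incid; case/andP: (valP (enum_val i)).
have EP d : is_affdim (Ppath F n p) d <-> d = (\rank (vecs_mx (Q (K := predT))))%:Z - 1.
  apply: (is_affdimE p_neq0 Ppath_sum) => [i|x]; first exact: QP.
  case/PpathP => m [v [l [[vP _ _ _] ->]]]; apply: summx_sub => i _.
  by apply: scalemx_sub; exact: span_incid.
have ET d : is_affdim (fun x => Ppath F n p x /\ dot g x = b) d <->
    d = (\rank (vecs_mx (Q (K := tight))))%:Z - 1.
  apply: (is_affdimE p_neq0) => [x [/Ppath_sum //]|i|]; last exact: face_span.
  split; first exact: QP.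
  by apply/eqP; case/andP: (valP (enum_val i)).
split=> [[_ [d [/EP -> /ET E]]]|E].
  by apply/eqP; rewrite -eqz_nat -addn1 PoszD -(addIr _ E) subrK.
split; first exact: Ppath_valid.
exists ((\rank (vecs_mx (Q (K := predT))))%:Z - 1); split; first exact/EP.
by apply/ET; rewrite -E -addn1 PoszD addrK.
Qed.

(** Adjoining the non-tight path [t0] raises the rank of the tight paths by exactly one. Hence the
    facet property says that the tight paths and [t0] span all paths, and the criterion is the dual
    form of this. *)
Lemma facet_criterion t0 : ppath n p t0 -> dot g (incid F n t0) != b ->
  facet_defining (Ppath F n p) (dot g) b <->
  forall c, (forall t, ppath n p t -> dot g (incid F n t) = b -> dot c (incid F n t) = 0) ->
    exists lam, forall t, ppath n p t ->
      dot c (incid F n t) = lam * (b - dot g (incid F n t)).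
Proof.
move=> t0P t0_ntight; apply: (iff_trans facet_rank).
set MT := vecs_mx (Q (K := tight)); set MA := vecs_mx (Q (K := predT)).
set x0 := rowv (incid F n t0).
have p_neq0 : p%:R != 0 :> F by rewrite pnatr_eq0 -lt0n.
pose colv (c : arc n -> F) : 'cV[F]_#|{: arc n}| := \col_j c (enum_val j).
have dotE c x : rowv x *m colv c = (dot c x)%:M.
  by rewrite rowv_mul /dot; congr _%:M; apply: eq_bigr => a _; rewrite mxE enum_rankK.
have MT_0 (c : 'cV_#|{: arc n}|) : (forall t, ppath n p t -> tight t ->
    rowv (incid F n t) *m c = 0) -> MT *m c = 0.
  move=> c0; apply/row_matrixP => i; rewrite row_mul rowK row0.
  by case/andP: (valP (enum_val i)) => ? ?; exact: c0.
(* The slack is made homogeneous: since the coordinates of a path sum to [p], the constant [b]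
   becomes the linear form with all coefficients [b / p]. *)
pose h a := b / p%:R - g a.
have hE t : ppath n p t -> dot h (incid F n t) = b - dot g (incid F n t).
  move=> tP; rewrite /dot; under eq_bigr do rewrite mulrBl.
  by rewrite sumrB -mulr_sumr sum_incid // divfK.
have MTh : MT *m colv h = 0.
  by apply: MT_0 => t tP /eqP tt; rewrite dotE hE // tt subrr raddf0.
have x0_notin : ~~ (x0 <= MT)%MS.
  apply/negP => /submxP [u x0E]; have := dotE h (incid F n t0).
  rewrite -/x0 x0E -mulmxA MTh mulmx0 hE // => /matrixP/(_ 0 0)/esym/eqP.
  by rewrite !mxE mulr1n subr_eq0 eq_sym; apply/negP.
have rk_cat : \rank (MT + x0)%MS = (\rank MT).+1.
  apply/eqP; rewrite eqn_leq; apply/andP; split.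
    rewrite -[leqRHS]addn1; apply: leq_trans (mxrank_adds_leqif _ _) _.
    by rewrite leq_add2l rank_leq_row.
  by apply: rank_ltmx; rewrite /ltmx addsmxSl addsmx_sub submx_refl.
have sub_cat : (MT + x0 <= MA)%MS.
  rewrite addsmx_sub span_incid // andbT; apply/row_subP => i; rewrite rowK.
  by case/andP: (valP (enum_val i)) => ? _; exact: span_incid.
split=> [E c c0|crit].
  have MTc : MT *m colv c = 0.
    by apply: MT_0 => t tP /eqP tt; rewrite dotE c0 // raddf0.
  (* The value at [t0] determines the multiplier; both sides then agree on the span of the tight
     paths and [t0]. *)
  exists (dot c (incid F n t0) / (b - dot g (incid F n t0))) => t tP.
  have : (rowv (incid F n t) <= MT + x0)%MS.
    have /eqmxP/eqmx_sym/eqmxP : (MT + x0 == MA)%MS.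
      by rewrite -(mxrank_leqif_eq sub_cat) rk_cat E.
    case/andP => MAs _; apply: submx_trans MAs; exact: span_incid.
  case/sub_addsmxP => -[u v] /= tE.
  have cE d : MT *m colv d = 0 ->
      (dot d (incid F n t))%:M = v *m (dot d (incid F n t0))%:M.
    by move=> d0; rewrite -!dotE tE mulmxDl -!mulmxA d0 mulmx0 add0r.
  have cE1 d : MT *m colv d = 0 ->
      dot d (incid F n t) = v 0 0 * dot d (incid F n t0).
    move=> /cE /matrixP /(_ 0 0); rewrite mul_mx_scalar !mxE mulr1n => ->.
    by rewrite mulrC.
  rewrite -(hE t) // (cE1 c) // (cE1 h) // (hE t0) // mulrCA divfK // subr_eq0 eq_sym.
  exact: t0_ntight.
suff AE : (MA <= MT + x0)%MS.
  by rewrite -rk_cat; apply/eqP; rewrite eqn_leq !mxrankS.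
apply/row_subP => i; rewrite rowK submxE; apply/eqP/row_matrixP => k; rewrite row0.
apply/rowP => j; rewrite !mxE.
(* Each column of the cokernel is a form vanishing on the tight paths and on [t0]. By the criterion
   it is a multiple of the slack, and the value zero at [t0] makes that multiple zero. *)
set C := cokermx _.
have MTC : MT *m C = 0.
  by apply/eqP; rewrite -submxE addsmxSl.
have x0C : x0 *m C = 0.
  by apply/eqP; rewrite -submxE addsmxSr.
pose c a := C (enum_rank a) j.
have cE t : dot c (incid F n t) = (rowv (incid F n t) *m C) 0 j.
  rewrite mxE /dot (big_enum_val (A := {: arc n})); apply: eq_bigr => l _.
  by rewrite mxE /c enum_valK mulrC.
case: (crit c) => [t tP /eqP tt|lam lamE].
  have /submxP[u uE] := span_incid (K := tight) tP tt.
  by rewrite cE uE -mulmxA MTC mulmx0 mxE.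
have /eqP : dot c (incid F n t0) = 0 by rewrite cE x0C mxE.
rewrite lamE // mulf_eq0 subr_eq0 [b == _]eq_sym (negPf t0_ntight) orbF => /eqP lam0.
have := cE (val (val (enum_val i))); rewrite lamE ?lam0 ?mul0r.
  by rewrite mxE ord1 /Q.
by case/andP: (valP (enum_val i)).
Qed.

End FacetCriterion.

(** * Sums along paths *)

Section WalkSums.
Variables (F : realFieldType) (V : Type).
Implicit Types (x y : V) (s : seq V).

Fixpoint wsum (f : V -> V -> F) x s : F :=
  if s is y :: s' then f x y + wsum f y s' else 0.

(** The version over natural numbers brings the counting arguments within reach of [lia]. *)
Fixpoint nsum (f : V -> V -> nat) x s : nat :=
  if s is y :: s' then (f x y + nsum f y s')%N else 0%N.

Lemma wsum_cat f x s1 s2 : wsum f x (s1 ++ s2) = wsum f x s1 + wsum f (last x s1) s2.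
Proof. by elim: s1 x => [|y s1 IH] x /=; rewrite ?add0r // IH addrA. Qed.

Lemma nsum_cat f x s1 s2 : nsum f x (s1 ++ s2) = (nsum f x s1 + nsum f (last x s1) s2)%N.
Proof. by elim: s1 x => [|y s1 IH] x /=; rewrite ?add0n // IH addnA. Qed.

Lemma wsum_nat f x s : wsum (fun i j => (f i j)%:R) x s = (nsum f x s)%:R.
Proof. by elim: s x => [//|y s IH] x /=; rewrite IH natrD. Qed.

Lemma wsum_zip f x s : wsum f x s = \sum_(e <- zip (x :: s) s) f e.1 e.2.
Proof. by elim: s x => [|y s IH] x /=; rewrite ?big_nil // IH big_cons. Qed.

Lemma wsum_const (a : F) x s : wsum (fun _ _ => a) x s = (size s)%:R * a.
Proof.
elim: s x => [|y s IH] x /=; first by rewrite mul0r.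
by rewrite IH -[(size s).+1]add1n natrD mulrDl mul1r.
Qed.

Lemma wsumD f1 f2 x s :
  wsum (fun i j => f1 i j + f2 i j) x s = wsum f1 x s + wsum f2 x s.
Proof. by elim: s x => [|y s IH] x /=; rewrite ?addr0 // IH addrACA. Qed.

Lemma wsumZ (a : F) f x s : wsum (fun i j => a * f i j) x s = a * wsum f x s.
Proof. by elim: s x => [|y s IH] x /=; rewrite ?mulr0 // IH mulrDr. Qed.

(** The sum telescopes, so a potential difference takes the same value on all paths from 0 to n. *)
Lemma wsum_potential (u : V -> F) x s :
  wsum (fun i j => u i - u j) x s = u x - u (last x s).
Proof. by elim: s x => [|y s IH] x /=; rewrite ?subrr // IH addrA subrK. Qed.

Lemma nsumD f1 f2 x s : nsum (fun i j => f1 i j + f2 i j)%N x s = (nsum f1 x s + nsum f2 x s)%N.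
Proof. by elim: s x => [//|y s IH] x /=; rewrite IH addnACA. Qed.

Lemma eq_nsum f1 f2 x s : (forall i j, f1 i j = f2 i j) -> nsum f1 x s = nsum f2 x s.
Proof. by move=> f12; elim: s x => [//|y s IH] x /=; rewrite IH f12. Qed.

End WalkSums.

Lemma wsum_map (F : realFieldType) (V W : Type) (h : V -> W) (f : W -> W -> F) x s :
  wsum f (h x) (map h s) = wsum (fun i j => f (h i) (h j)) x s.
Proof. by elim: s x => [//|y s IH] x /=; rewrite IH. Qed.

Lemma nsum_map (V W : Type) (h : V -> W) (f : W -> W -> nat) x s :
  nsum f (h x) (map h s) = nsum (fun i j => f (h i) (h j)) x s.
Proof. by elim: s x => [//|y s IH] x /=; rewrite IH. Qed.

Section ArcSums.
Variables (F : realFieldType) (n : nat).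
Implicit Types (x y : 'I_n.+1) (s t : seq 'I_n.+1).

Lemma eq_wsum_path (f1 f2 : 'I_n.+1 -> 'I_n.+1 -> F) x s :
  (forall i j, arcb n (i, j) -> f1 i j = f2 i j) ->
  path (fun i j => arcb n (i, j)) x s -> wsum f1 x s = wsum f2 x s.
Proof.
move=> f12; elim: s x => [//|y s IH] x /= /andP[xy ys].
by rewrite f12 // IH.
Qed.

Lemma dot_incid p (f : 'I_n.+1 -> 'I_n.+1 -> F) t : ppath n p t ->
  dot (fun a : arc n => f (tl a) (hd a)) (incid F n t) = wsum f ord0 t.
Proof.
case/and4P => _ /= /andP[_ t_uniq] t_path _; rewrite wsum_zip.
(* The consecutive pairs are lifted to the type of arcs. They are distinct because the heads are, so
   the sum over the list is a sum over a set of arcs. *)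
set z := zip _ _; pose s : seq (arc n) := pmap insub z.
have z_arc : all (arcb n) z.
  rewrite /z; elim: t ord0 {t_uniq s z} t_path => [//|y t IH] x /= /andP[-> /=].
  exact: IH.
have sE : map val s = z.
  rewrite (pmap_filter (@insubK _ _ (arc n))); apply/all_filterP.
  by apply: sub_all z_arc => e eA; rewrite insubT.
have s_uniq : uniq s by apply: pmap_sub_uniq; exact: zip_uniqr.
rewrite -[in RHS]sE big_map -[RHS]/(\sum_(a <- s) f (tl a) (hd a)).
rewrite big_uniq // [RHS]big_mkcond; apply: eq_bigr => a _.
by rewrite /incid -/z mem_pmap_sub; case: ifP; rewrite ?mulr1 ?mulr0.
Qed.

End ArcSums.

(** * Paths as lists of distinct internal nodes *)

Section PathShape.
Variables (n : nat).
Hypothesis n_gt0 : (0 < n)%N.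
Implicit Types (x y : 'I_n.+1) (s t : seq 'I_n.+1).

Definition internal x := (x != ord0) && (x != ord_max).

Lemma ord0_neq_max : ord0 != ord_max :> 'I_n.+1.
Proof. by rewrite -val_eqE /= eq_sym -lt0n. Qed.

(** Distinct internal nodes are always joined by an arc, node 0 has an arc to each of them and each
    has an arc to n. As [1 < p], the absent arc from 0 to n never occurs. *)
Lemma ppathP p t : (1 < p)%N ->
  reflect (exists s, [/\ t = rcons s ord_max, uniq s, all internal s & size s = p.-1])
          (ppath n p t).
Proof.
move=> p_gt1; apply: (iffP idP) => [|[s [-> s_uniq s_int s_size]]].
  case/and4P => /eqP t_size t_uniq t_path t_last.
  case: (lastP t) t_size t_uniq t_path t_last => [/eqP|s z].
    by rewrite eq_sym gtn_eqF // ltnW.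
  rewrite size_rcons last_rcons => t_size /= /andP[s0 s_uniq] _ /eqP z_max.
  rewrite z_max in s0 s_uniq *; exists s.
  move: s_uniq s0; rewrite rcons_uniq mem_rcons inE negb_or => /andP[smax ->] /andP[_ s0].
  split=> //; last by rewrite -t_size.
  apply/allP => x xs; apply/andP; split; first by apply: contraNneq s0 => <-.
  by apply: contraNneq smax => <-.
have path_int x s' : uniq (x :: s') -> all internal s' -> x != ord_max ->
    path (fun i j => arcb n (i, j)) x s'.
  elim: s' x => [//|y s' IH] x /= /andP[]; rewrite inE negb_or.
  move=> /andP[xy _] /andP[ys s'_uniq] /andP[/andP[y0 ym] s'_int] xm.
  rewrite IH /= ?ys ?s'_uniq // andbT /arcb /= xy y0 xm /=.
  by rewrite (negPf ym) andbF.
have s0 : ord0 \notin s.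
  by apply: contraL s_int => H; apply/allPn; exists ord0; rewrite // /internal eqxx.
have sm : ord_max \notin s.
  by apply: contraL s_int => H; apply/allPn; exists ord_max; rewrite // /internal eqxx andbF.
rewrite /ppath size_rcons s_size prednK ?(ltnW p_gt1) // eqxx last_rcons eqxx andbT.
rewrite /= mem_rcons inE negb_or ord0_neq_max s0 rcons_uniq sm s_uniq /=.
rewrite rcons_path path_int /= ?s0 ?ord0_neq_max //.
have last_s : last ord0 s \in s.
  by case: (s) s_size p_gt1 => [|y s' _ _]; [case: (p) => [|[]]|rewrite /= mem_last].
have /andP[l0 lm] := allP s_int _ last_s.
by rewrite /arcb /= (negPf l0) lm [ord_max == _]eq_sym ord0_neq_max.
Qed.

(** There are n-1 internal nodes, at least [p] in number, so the p-1 inner nodes of a path can be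
    found even when [v] is avoided. *)
Lemma ppath_extend p s v : (1 < p <= n - 1)%N -> uniq s -> all internal s ->
  (size s < p)%N -> v \notin s ->
  exists s', [/\ ppath n p (s ++ rcons s' ord_max), all internal s', uniq (s ++ s')
    & v \notin s ++ s'].
Proof.
move=> /andP[p_gt1 p_le] s_uniq s_int s_size vs.
pose U := [set x | internal x]; pose B := [set x in v :: s].
pose rest := enum (U :\: B).
have rest_size : (n - 1 <= size rest + (size s).+1)%N.
  have cU : #|U| = (n - 1)%N.
    have := cardsC U; rewrite card_ord.
    have -> : ~: U = [set ord0; ord_max].
      by apply/setP => x; rewrite !inE negb_and !negbK.
    by rewrite cards2 ord0_neq_max /=; lia.
  rewrite -cardE -cU -(cardsID B U) addnC leq_add2l.
  apply: leq_trans (subset_leq_card (subsetIr _ _)) _.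
  by rewrite cardsE card_size.
pose s' := take (p.-1 - size s) rest.
have rest_uniq : uniq rest by rewrite enum_uniq.
have s'_rest x : x \in s' -> internal x && (x \notin v :: s).
  by move=> /mem_take; rewrite mem_enum !inE andbC.
have s'_uniq : uniq (s ++ s').
  rewrite cat_uniq s_uniq take_uniq // andbT; apply/hasPn => x /s'_rest /andP[_].
  by rewrite inE negb_or => /andP[].
have s'_int : all internal s' by apply/allP => x /s'_rest /andP[].
exists s'; split=> //; last first.
  by rewrite mem_cat negb_or vs; apply/negP => /s'_rest; rewrite inE eqxx andbF.
apply/ppathP => //; exists (s ++ s'); split=> //; rewrite ?rcons_cat ?all_cat ?s_int //.
rewrite size_cat size_take_min (minn_idPl _) ?subnKC //.
  by rewrite -ltnS prednK // ltnW.
have : (p.-1 <= size s + size rest)%N.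
  by rewrite -ltnS prednK ?(ltnW p_gt1) // -addSn addnC; exact: leq_trans p_le _.
by rewrite leq_subLR.
Qed.

End PathShape.

(* Nodes are given by their index in a list starting with node 0 of the digraph; the entries
   0, 1, 2 of [lab] tell whether a node lies in R, S, T. A fragment consists of the nodes [I]
   after node 0 and the nodes [J] before node n of a path; it becomes a tight path when the
   gap is filled with S-T pairs and the R-nodes not in the list. Here 2 [e] is the length of a
   fragment without R-nodes, and the label 1 appended to [J] is that of node n. *)
Definition glab (a b : nat) : nat := (a == 0)%N || (a == 1)%N && (b == 2)%N.

Definition fragment (e : nat) (lab I J : seq nat) : bool :=
  let l := nth 1%N lab in
  [&& uniq (I ++ J), all (fun i => 0 < i < size lab)%N (I ++ J),
      head 1%N (map l J) != 2%N, (size (I ++ J) == 2 * e + count_mem 0 lab)%N &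
      (nsum glab 1 (map l I) + (last 1%N (map l I) == 0%N) +
       nsum glab (head 1%N (map l J)) (behead (rcons (map l J) 1%N)) ==
       e + count_mem 0 lab)%N].

(* The pairs used in the next two proofs are a basis of the relations between fragments;
   together with the seven zero arcs they determine all 25 weights. *)
Lemma lin_zero_2 (F : realFieldType) (a : nat -> nat -> F) :
  (forall I I', fragment 2 [:: 1; 1; 1; 2; 2; 2]%N I [::] ->
     fragment 2 [:: 1; 1; 1; 2; 2; 2]%N I' [::] -> last 0%N I = last 0%N I' ->
     wsum a 0 I = wsum a 0 I') ->
  a 0 3 = 0 -> a 0 4 = 0 -> a 0 5 = 0 -> a 1 3 = 0 -> a 2 3 = 0 -> a 3 1 = 0 -> a 0 1 = 0 ->
  forall i j, (i < 6)%N -> (0 < j < 6)%N -> i != j -> a i j = 0.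
Proof.
move=> H.
have := H [:: 3; 2; 4; 1]%N [:: 3; 2; 5; 1]%N isT isT erefl.
have := H [:: 3; 2; 4; 1]%N [:: 4; 2; 3; 1]%N isT isT erefl.
have := H [:: 3; 2; 4; 1]%N [:: 4; 2; 5; 1]%N isT isT erefl.
have := H [:: 3; 2; 4; 1]%N [:: 5; 2; 3; 1]%N isT isT erefl.
have := H [:: 3; 1; 4; 2]%N [:: 3; 1; 5; 2]%N isT isT erefl.
have := H [:: 3; 1; 4; 2]%N [:: 4; 1; 3; 2]%N isT isT erefl.
have := H [:: 3; 1; 4; 2]%N [:: 4; 1; 5; 2]%N isT isT erefl.
have := H [:: 3; 1; 4; 2]%N [:: 5; 1; 3; 2]%N isT isT erefl.
have := H [:: 1; 4; 2; 3]%N [:: 2; 4; 1; 3]%N isT isT erefl.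
have := H [:: 1; 4; 2; 3]%N [:: 4; 1; 2; 3]%N isT isT erefl.
have := H [:: 1; 4; 2; 3]%N [:: 4; 1; 5; 3]%N isT isT erefl.
have := H [:: 1; 4; 2; 3]%N [:: 4; 2; 1; 3]%N isT isT erefl.
have := H [:: 1; 4; 2; 3]%N [:: 4; 2; 5; 3]%N isT isT erefl.
have := H [:: 1; 4; 2; 3]%N [:: 4; 5; 1; 3]%N isT isT erefl.
have := H [:: 1; 4; 2; 3]%N [:: 5; 1; 4; 3]%N isT isT erefl.
have := H [:: 1; 4; 2; 3]%N [:: 5; 4; 1; 3]%N isT isT erefl.
have := H [:: 1; 3; 2; 4]%N [:: 3; 5; 1; 4]%N isT isT erefl.
have := H [:: 1; 3; 2; 4]%N [:: 5; 1; 3; 4]%N isT isT erefl.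
rewrite /= {H}; do 25!move=> ?.
case=> [|[|[|[|[|[|//]]]]]]; case=> [|[|[|[|[|[|//]]]]]] // _ _ _; lra.
Qed.

Lemma lin_zero_1 (F : realFieldType) (a : nat -> nat -> F) :
  (forall I I', fragment 1 [:: 1; 1; 2; 2; 0; 0]%N I [::] ->
     fragment 1 [:: 1; 1; 2; 2; 0; 0]%N I' [::] -> last 0%N I = last 0%N I' ->
     wsum a 0 I = wsum a 0 I') ->
  a 0 2 = 0 -> a 0 3 = 0 -> a 1 2 = 0 -> a 2 4 = 0 -> a 2 5 = 0 -> a 2 1 = 0 -> a 4 1 = 0 ->
  forall i j, (i < 6)%N -> (0 < j < 6)%N -> i != j -> a i j = 0.
Proof.
move=> H.
have := H [:: 2; 4; 5; 1]%N [:: 2; 5; 4; 1]%N isT isT erefl.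
have := H [:: 2; 4; 5; 1]%N [:: 3; 4; 5; 1]%N isT isT erefl.
have := H [:: 2; 4; 5; 1]%N [:: 3; 5; 4; 1]%N isT isT erefl.
have := H [:: 3; 4; 1; 2]%N [:: 3; 4; 5; 2]%N isT isT erefl.
have := H [:: 3; 4; 1; 2]%N [:: 3; 5; 1; 2]%N isT isT erefl.
have := H [:: 3; 4; 1; 2]%N [:: 3; 5; 4; 2]%N isT isT erefl.
have := H [:: 3; 4; 1; 2]%N [:: 4; 5; 1; 2]%N isT isT erefl.
have := H [:: 3; 4; 1; 2]%N [:: 5; 4; 1; 2]%N isT isT erefl.
have := H [:: 2; 4; 1; 3]%N [:: 2; 4; 5; 3]%N isT isT erefl.
have := H [:: 2; 4; 1; 3]%N [:: 2; 5; 4; 3]%N isT isT erefl.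
have := H [:: 1; 2; 5; 4]%N [:: 1; 3; 5; 4]%N isT isT erefl.
have := H [:: 1; 2; 5; 4]%N [:: 2; 1; 3; 4]%N isT isT erefl.
have := H [:: 1; 2; 5; 4]%N [:: 2; 1; 5; 4]%N isT isT erefl.
have := H [:: 1; 2; 5; 4]%N [:: 2; 3; 5; 4]%N isT isT erefl.
have := H [:: 1; 2; 5; 4]%N [:: 2; 5; 1; 4]%N isT isT erefl.
have := H [:: 1; 2; 5; 4]%N [:: 2; 5; 3; 4]%N isT isT erefl.
have := H [:: 1; 2; 5; 4]%N [:: 3; 1; 2; 4]%N isT isT erefl.
have := H [:: 1; 2; 5; 4]%N [:: 3; 2; 5; 4]%N isT isT erefl.
rewrite /= {H}; do 25!move=> ?.
case=> [|[|[|[|[|[|//]]]]]]; case=> [|[|[|[|[|[|//]]]]]] // _ _ _; lra.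
Qed.

(** * Validity and facets of the inequality *)

Section ArcCounts.
Variable n : nat.
Implicit Types (x y i j v w : 'I_n.+1) (s t : seq 'I_n.+1) (f : 'I_n.+1 -> 'I_n.+1 -> nat).

Definition arcs_of x s := zip (x :: s) s.

Lemma nsum_tail (P : pred 'I_n.+1) x s : nsum (fun i _ => P i) x s = count P (belast x s).
Proof. by elim: s x => [//|y s IH] x /=; rewrite IH. Qed.

Lemma nsum_head (P : pred 'I_n.+1) x s : nsum (fun _ j => P j) x s = count P s.
Proof. by elim: s x => [//|y s IH] x /=; rewrite IH. Qed.

Lemma leq_nsum f i j x s : (i, j) \in arcs_of x s -> (f i j <= nsum f x s)%N.
Proof.
elim: s x => [//|y s IH] x /=; rewrite inE => /orP[/eqP[-> ->]|/IH]; first exact: leq_addr.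
by move=> /leq_trans; apply; exact: leq_addl.
Qed.

Lemma nsum_indicator i j x s :
  nsum (fun k l => (k == i) && (l == j)) x s = count_mem (i, j) (arcs_of x s).
Proof. by elim: s x => [//|y s IH] x /=; rewrite IH /arcs_of. Qed.

Lemma mem_arcs_head i j x s : (i, j) \in arcs_of x s -> j \in s.
Proof.
elim: s x => [//|y s IH] x /=; rewrite !inE => /orP[/eqP[_ ->]|/IH ->]; first by rewrite eqxx.
by rewrite orbT.
Qed.

Lemma mem_arcs_tail i j x s : (i, j) \in arcs_of x s -> i \in belast x s.
Proof.
elim: s x => [//|y s IH] x /=; rewrite !inE => /orP[/eqP[-> _]|/IH ->]; first by rewrite eqxx.
by rewrite orbT.
Qed.

Lemma arcs_pred_uniq i i' j x s : uniq s ->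
  (i, j) \in arcs_of x s -> (i', j) \in arcs_of x s -> i = i'.
Proof.
elim: s x => [//|y s IH] x /= /andP[ys s_uniq]; rewrite !inE.
case/orP=> [/eqP[-> ->]|ij].
  by case/orP=> [/eqP[->]//|ij']; rewrite (mem_arcs_head ij') in ys.
case/orP=> [/eqP[_ e]|ij']; last exact: IH ij ij'.
by rewrite -e (mem_arcs_head ij) in ys.
Qed.

Definition cnt (X : {set 'I_n.+1}) (s : seq 'I_n.+1) : nat := count [in X] s.

Lemma cnt_cons (X : {set 'I_n.+1}) x s : cnt X (x :: s) = ((x \in X) + cnt X s)%N.
Proof. by []. Qed.

Lemma cnt_leq_card (X : {set 'I_n.+1}) s : uniq s -> (cnt X s <= #|X|)%N.
Proof.
move=> s_uniq; rewrite /cnt -size_filter cardE; apply: uniq_leq_size.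
  by rewrite filter_uniq.
by move=> x; rewrite mem_filter mem_enum => /andP[].
Qed.

Lemma cnt_ltn_card (X : {set 'I_n.+1}) s v : uniq s -> v \in X -> v \notin s ->
  (cnt X s < #|X|)%N.
Proof.
move=> s_uniq vX vs; have /(cnt_leq_card X) : uniq (v :: s) by rewrite /= vs.
by rewrite cnt_cons vX add1n.
Qed.

End ArcCounts.

Section GeneralizedMaxCut.
Variables (n p : nat) (Rs Ss Ts : {set 'I_n.+1}).
Hypothesis p_ge4 : (4 <= p)%N.
Hypothesis p_le : (p <= n - 1)%N.
(** The numerical form of a partition lets class counts be added up and handed to [lia]. *)
Hypothesis part : forall x, ((x \in Rs) + (x \in Ss) + (x \in Ts) = 1)%N.
Hypothesis S0 : ord0 \in Ss.
Hypothesis Sn : ord_max \in Ss.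
Implicit Types (x y i j v w : 'I_n.+1) (s : seq 'I_n.+1).

Let n_gt0 : (0 < n)%N. Proof. lia. Qed.
Let p_gt1 : (1 < p)%N. Proof. lia. Qed.

Definition gcoef i j : nat := (i \in Rs) || (i \in Ss) && (j \in Ts).
Definition badS i j : nat := (i \in Ss) && (j \notin Ts).
Definition badT i j : nat := (i \notin Ss) && (j \in Ts).
Definition gval t := nsum gcoef ord0 t.
Definition bound := ((p + #|Rs|)./2)%N.

Lemma R_notS x : x \in Rs -> x \notin Ss.
Proof. by move=> xR; have := part x; rewrite xR; case: (_ \in _). Qed.

Lemma R_notT x : x \in Rs -> x \notin Ts.
Proof. by move=> xR; have := part x; rewrite xR; do 2!case: (_ \in _). Qed.

Lemma S_notR x : x \in Ss -> x \notin Rs.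
Proof. by move=> xS; have := part x; rewrite xS; case: (_ \in _). Qed.

Lemma S_notT x : x \in Ss -> x \notin Ts.
Proof. by move=> xS; have := part x; rewrite xS; do 2!case: (_ \in _). Qed.

Lemma T_notR x : x \in Ts -> x \notin Rs.
Proof. by move=> xT; have := part x; rewrite xT; do 2!case: (_ \in _). Qed.

Lemma T_notS x : x \in Ts -> x \notin Ss.
Proof. by move=> xT; have := part x; rewrite xT; do 2!case: (_ \in _). Qed.

Lemma notRS_T x : x \notin Rs -> x \notin Ss -> x \in Ts.
Proof. by move=> xR xS; have := part x; rewrite (negPf xR) (negPf xS); case: (_ \in _). Qed.

Lemma notRT_S x : x \notin Rs -> x \notin Ts -> x \in Ss.
Proof. by move=> xR xT; have := part x; rewrite (negPf xR) (negPf xT); case: (_ \in _). Qed.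

(** An arc that leaves a node of R or S is either counted by [gcoef] or bad at S, and never both.
    The extra 1 stands for the arc leaving node 0. *)
Lemma gval_badS s : (gval (rcons s ord_max) + nsum badS ord0 (rcons s ord_max) =
  cnt Rs s + cnt Ss s + 1)%N.
Proof.
rewrite /gval -nsumD (@eq_nsum _ _ (fun i _ => [predU Rs & Ss] i : nat)).
  rewrite nsum_tail belast_rcons /= S0 orbT /cnt -count_predUI.
  rewrite [count (predI _ _) s](@eq_count _ _ pred0) ?count_pred0.
    by rewrite addn0 add1n addn1.
  by move=> x /=; have := part x; case: (x \in Rs); case: (x \in Ss).
move=> i j; rewrite /gcoef /badS /=; have := part i.
by case: (i \in Rs); case: (i \in Ss); case: (j \in Ts); case: (i \in Ts).
Qed.

(** Arc by arc, [gcoef] plus [badT] is the indicator of a tail in R plus that of a head in T; an arc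
    from R to T counts twice on both sides. The ends 0 and n lie in S and contribute nothing. *)
Lemma gval_badT s : (gval (rcons s ord_max) + nsum badT ord0 (rcons s ord_max) =
  cnt Rs s + cnt Ts s)%N.
Proof.
rewrite /gval -nsumD (@eq_nsum _ _ (fun i j => (i \in Rs) + (j \in Ts))%N).
  rewrite /cnt nsumD (nsum_tail [in Rs]) (nsum_head [in Ts]) belast_rcons /= -cats1 count_cat /=.
  by have := part ord0; have := part ord_max; rewrite S0 Sn; lia.
move=> i j; rewrite /gcoef /badT /=; have := part i.
by case: (i \in Rs); case: (i \in Ss); case: (j \in Ts); case: (i \in Ts).
Qed.

Lemma cnt_classes s : (cnt Rs s + cnt Ss s + cnt Ts s = size s)%N.
Proof. by elim: s => // x s; rewrite !cnt_cons /=; move: (part x); do 3!case: (_ \in _); lia. Qed.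

Lemma cnt_S_leq s : uniq s -> all (@internal n) s -> (cnt Ss s + 2 <= #|Ss|)%N.
Proof.
move=> s_uniq s_int.
have s0 x : ~~ internal x -> x \notin s by move=> xi; apply: contra xi => /(allP s_int).
have : uniq [:: ord0, ord_max & s].
  rewrite /= inE negb_or ord0_neq_max // s_uniq !s0 //; by rewrite /internal eqxx ?andbF.
by move=> /(cnt_leq_card Ss); rewrite !cnt_cons S0 Sn; lia.
Qed.

(** The sum of the two preceding identities bounds twice the value by [p] plus the number of visited
    R-nodes. *)
Lemma gval_leq t : ppath n p t -> (gval t <= bound)%N.
Proof.
case/(ppathP n_gt0 _ p_gt1) => s [-> s_uniq s_int s_size].
have := gval_badS s; have := gval_badT s; have := cnt_classes s.
have := cnt_leq_card Rs s_uniq; rewrite /bound; lia.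
Qed.

Section Facet.
Variable F : realFieldType.

Lemma gmc_lhsE (x : vec F n) :
  gmc_lhs Rs Ss Ts x = dot (fun a : arc n => (gcoef (tl a) (hd a))%:R) x.
Proof.
rewrite /gmc_lhs /dot (exchange_big_dep predT) //= [X in X + _]big_mkcond -big_split /=.
apply: eq_bigr => a _; have := part (tl a); rewrite /gcoef.
have -> : \sum_(i in Rs | tl a == i) x a = if tl a \in Rs then x a else 0.
  case: ifP => aR; last by rewrite big1 // => i /andP[iR /eqP e]; rewrite e iR in aR.
  rewrite (bigD1 (tl a)) /= ?aR ?eqxx // big1 ?addr0 // => i.
  by case/andP=> /andP[_ /eqP ->]; rewrite eqxx.
case: (tl a \in Rs) => /=; case: (tl a \in Ss) => //=; case: (hd a \in Ts);
  by rewrite ?mul0r ?mul1r ?add0r ?addr0.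
Qed.

Let dot_gval t : ppath n p t ->
  dot (fun a : arc n => (gcoef (tl a) (hd a))%:R) (incid F n t) = (gval t)%:R.
Proof. by move=> tP; rewrite (dot_incid (fun i j => (gcoef i j)%:R) tP) wsum_nat. Qed.

Let sum_incid t : ppath n p t -> \sum_a incid F n t a = p%:R.
Proof.
move=> tP; have := dot_incid (fun _ _ => 1 : F) tP; rewrite wsum_const mulr1.
have /and4P[/eqP -> _ _ _] := tP => <-.
by apply: eq_bigr => a _; rewrite mul1r.
Qed.

Let dot_leq t : ppath n p t ->
  dot (fun a : arc n => (gcoef (tl a) (hd a))%:R) (incid F n t) <= bound%:R.
Proof. by move=> tP; rewrite dot_gval // ler_nat gval_leq. Qed.

Lemma gmc_valid : valid_ineq (Ppath F n p) (gmc_lhs Rs Ss Ts) bound%:R.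
Proof. by move=> x xP; rewrite gmc_lhsE; exact: Ppath_valid xP. Qed.

(** Serves to replace [gmc_lhs] by [dot], as the two faces are equivalent predicates only
    pointwise. *)
Let is_affdim_ext (X Y : vec F n -> Prop) d :
  (forall x : vec F n, X x <-> Y x) -> is_affdim X d -> is_affdim Y d.
Proof.
move=> XY; have ext k : affdim_ge X k <-> affdim_ge Y k.
  by split=> -[f [fX find]]; exists f; split=> // i; apply/XY.
case=> [[-> X0]|[k [-> Xk Xk1]]]; [left|right].
  by split=> // x /XY; exact: X0.
by exists k; split=> //; [apply/ext|move/ext].
Qed.

Lemma gmc_facet t0 : ppath n p t0 -> gval t0 != bound ->
  facet_defining (Ppath F n p) (gmc_lhs Rs Ss Ts) bound%:R <->
  forall f, (forall t, ppath n p t -> gval t = bound -> wsum f ord0 t = 0) ->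
    exists lam : F, forall t, ppath n p t ->
      wsum f ord0 t = lam * (bound%:R - (gval t)%:R).
Proof.
move=> t0P t0_nt; set g := fun a : arc n => (gcoef (tl a) (hd a))%:R : F.
have t0_nt' : dot g (incid F n t0) != bound%:R by rewrite dot_gval // eqr_nat.
have crit := facet_criterion (ltnW p_gt1) sum_incid dot_leq t0P t0_nt'.
have facetE : facet_defining (Ppath F n p) (gmc_lhs Rs Ss Ts) bound%:R <->
    facet_defining (Ppath F n p) (dot g) bound%:R.
  split=> -[vl [d [Pd fd]]].
    split; first by move=> x /vl; rewrite gmc_lhsE.
    by exists d; split=> //; apply: is_affdim_ext fd => x; rewrite gmc_lhsE.
  split; first by move=> x /vl; rewrite gmc_lhsE.
  by exists d; split=> //; apply: is_affdim_ext fd => x; rewrite gmc_lhsE.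
apply: (iff_trans facetE); apply: (iff_trans crit); split=> [H f f0|H c c0].
  case: (H (fun a => f (tl a) (hd a))) => [t tP|lam lamE].
    by rewrite dot_gval // (dot_incid f tP) => /eqP; rewrite eqr_nat => /eqP; exact: f0.
  by exists lam => t tP; rewrite -(dot_incid f tP) lamE // dot_gval.
(* A weight on arcs is extended by zero to all pairs of nodes. *)
pose f i j := if insub (i, j) is Some a then c a else 0.
have fE (a : arc n) : f (tl a) (hd a) = c a.
  by rewrite /f /tl /hd -surjective_pairing valK.
have dotE (x : vec F n) : dot c x = dot (fun a => f (tl a) (hd a)) x.
  by apply: eq_bigr => a _; rewrite fE.
case: (H f) => [t tP tb|lam lamE].
  by rewrite -(dot_incid f tP) -dotE c0 // dot_gval // tb.
by exists lam => t tP; rewrite dotE (dot_incid f tP) lamE // dot_gval.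
Qed.

(* The tight paths then all lie on the face [x_ij = 0], which is a different one. *)
Lemma not_facet_of_arc i j t1 t2 :
  (forall t, ppath n p t -> (i, j) \in arcs_of ord0 t -> gval t != bound) ->
  ppath n p t1 -> (i, j) \in arcs_of ord0 t1 ->
  ppath n p t2 -> (i, j) \notin arcs_of ord0 t2 -> gval t2 != bound ->
  ~ facet_defining (Ppath F n p) (gmc_lhs Rs Ss Ts) bound%:R.
Proof.
move=> ij_nt t1P t1ij t2P t2ij t2_nt /(gmc_facet t2P t2_nt).
move=> /(_ (fun k l => ((k == i) && (l == j))%:R)) [t tP tb|lam lamE].
  rewrite (wsum_nat _ (fun k l => (k == i) && (l == j))) nsum_indicator.
  rewrite (count_memPn _) //; apply/negP => /(ij_nt t tP); by rewrite tb eqxx.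
(* The non-tight path [t2] avoids the arc, which forces [lam] to be zero; then the indicator of the
   arc would vanish on [t1], which uses it. *)
have := lamE t2 t2P; rewrite (wsum_nat _ (fun k l => (k == i) && (l == j))) nsum_indicator.
rewrite (count_memPn t2ij) => /esym/eqP; rewrite mulf_eq0 subr_eq0 eqr_nat [bound == _]eq_sym.
rewrite (negPf t2_nt) orbF => /eqP lam0.
have := lamE t1 t1P; rewrite (wsum_nat _ (fun k l => (k == i) && (l == j))) nsum_indicator.
by rewrite lam0 mul0r => /eqP; rewrite pnatr_eq0 => /eqP/count_memPn; rewrite t1ij.
Qed.

(** * Necessity *)

Definition inner (q : seq 'I_n.+1) := [&& uniq q, all (@internal n) q & size q == p.-1].
Definition gv (q : seq 'I_n.+1) := gval (rcons q ord_max).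
Definition nbadS (q : seq 'I_n.+1) := nsum badS ord0 (rcons q ord_max).
Definition nbadT (q : seq 'I_n.+1) := nsum badT ord0 (rcons q ord_max).
Notation arcs q := (arcs_of ord0 (rcons q ord_max)).
Notation facet := (facet_defining (Ppath F n p) (gmc_lhs Rs Ss Ts) bound%:R).

Lemma inner_ppath q : inner q -> ppath n p (rcons q ord_max).
Proof. by case/and3P => ? ? /eqP ?; apply/ppathP => //; exists q. Qed.

Lemma inner_uniq q : inner q -> uniq (rcons q ord_max).
Proof. by case/inner_ppath/and4P => _ /= /andP[]. Qed.

Lemma ppath_inner t : ppath n p t -> exists2 q, inner q & t = rcons q ord_max.
Proof. by case/(ppathP n_gt0 _ p_gt1) => q [-> ? ? /eqP ?]; exists q => //; apply/and3P. Qed.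

Lemma inner_extend s v : uniq s -> all (@internal n) s -> (size s < p)%N -> v \notin s ->
  exists s', inner (s ++ s') /\ v \notin s ++ s'.
Proof.
move=> s_uniq s_int s_size vs; have p2 : (1 < p <= n - 1)%N by rewrite p_gt1.
have [s' [tP s'_int ss' vs']] := ppath_extend n_gt0 p2 s_uniq s_int s_size vs.
exists s'; split=> //; rewrite /inner ss' all_cat s_int s'_int /=.
have /and4P[/eqP <- _ _ _] := tP.
by rewrite !size_cat size_rcons addnS.
Qed.

Lemma internal_neq0 x : internal x -> ord0 != x.
Proof. by case/andP; rewrite eq_sym. Qed.

Lemma inner_extend1 x : internal x -> exists s, inner (x :: s).
Proof.
move=> x_int; have [||||s [sP _]] := @inner_extend [:: x] ord0 => //=; last by exists s.
  by rewrite x_int.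
by rewrite inE internal_neq0.
Qed.

Lemma inner_extend2 x y : internal x -> internal y -> x != y -> exists s, inner [:: x, y & s].
Proof.
move=> x_int y_int xy.
have [||||s [sP _]] := @inner_extend [:: x; y] ord0 => //=; last by exists s.
- by rewrite inE xy.
- by rewrite x_int y_int.
- lia.
by rewrite !inE negb_or !internal_neq0.
Qed.

Lemma arcs_head_in q i j : internal j -> (i, j) \in arcs q -> j \in q.
Proof.
move=> j_int /mem_arcs_head; rewrite mem_rcons inE => /orP[/eqP e|//].
by move: j_int; rewrite e /internal eqxx andbF.
Qed.

Lemma internal_R x : x \in Rs -> internal x.
Proof.
by move=> xR; apply/andP; split; apply: contraTneq xR => ->; exact: S_notR.
Qed.

Lemma internal_T x : x \in Ts -> internal x.
Proof.
by move=> xT; apply/andP; split; apply: contraTneq xT => ->; exact: S_notT.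
Qed.

Lemma cnt_gt0 (X : {set 'I_n.+1}) s x : x \in s -> x \in X -> (0 < cnt X s)%N.
Proof. by move=> xs xX; rewrite /cnt -has_count; apply/hasP; exists x. Qed.

(** Together with [bound_double] this is all the arithmetic of a path that [by_counts] passes to
    [lia]. *)
Lemma inner_counts q : inner q ->
  (gv q + nbadS q = cnt Rs q + cnt Ss q + 1 /\
   gv q + nbadT q = cnt Rs q + cnt Ts q /\
   cnt Rs q + cnt Ss q + cnt Ts q = p.-1 /\
   (cnt Rs q <= #|Rs|) /\ (cnt Ss q + 2 <= #|Ss|) /\
   (cnt Ts q <= #|Ts|))%N.
Proof.
case/and3P=> q_uniq q_int /eqP q_size; rewrite /gv /nbadS /nbadT gval_badS gval_badT cnt_classes.
by rewrite !cnt_leq_card // cnt_S_leq.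
Qed.

Lemma bound_double : (odd (p + #|Rs|) + 2 * bound = p + #|Rs|)%N.
Proof. by rewrite mul2n odd_double_half. Qed.

Ltac by_counts qP := move: (inner_counts qP) bound_double p_ge4; clear; lia.

Lemma badS_arc q i j : (i, j) \in arcs q -> i \in Ss -> j \notin Ts ->
  (0 < nbadS q)%N.
Proof. by move=> ijq iS jT; have := leq_nsum badS ijq; rewrite /badS iS jT. Qed.

Lemma badT_arc q i j : (i, j) \in arcs q -> i \notin Ss -> j \in Ts ->
  (0 < nbadT q)%N.
Proof. by move=> ijq iS jT; have := leq_nsum badT ijq; rewrite /badT iS jT. Qed.

(** The situation is that every tight path visits [v] but none enters it from [i]. A path missing
    [v] then serves as the non-tight path off the arc. *)
Lemma not_facet_avoid i v : i = ord0 \/ internal i -> internal v -> i != v ->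
  (forall q, inner q -> (i, v) \in arcs q -> gv q != bound) ->
  (forall q, inner q -> v \notin q -> gv q != bound) -> ~ facet.
Proof.
move=> i_int v_int iv arc_nt avoid_nt.
have [q1 q1P q1a] : exists2 q, inner q & (i, v) \in arcs q.
  case: i_int => [->|i_int].
    have [s sP] := inner_extend1 v_int.
    by exists (v :: s) => //=; rewrite inE eqxx.
  have [s sP] := inner_extend2 i_int v_int iv.
  by exists [:: i, v & s] => //=; rewrite !inE eqxx orbT.
have [||||q2 [q2P q2v]] := @inner_extend [::] v => //=; first lia.
apply: (@not_facet_of_arc i v _ _ _ (inner_ppath q1P) q1a (inner_ppath q2P)).
- by move=> t /ppath_inner [q qP ->]; exact: arc_nt.
- by apply: contra q2v; exact: arcs_head_in.
exact: avoid_nt.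
Qed.

Lemma not_facet_none : (forall q, inner q -> gv q != bound) -> ~ facet.
Proof.
move=> nt; pose v : 'I_n.+1 := inord 1.
have v_int : internal v.
  by apply/andP; split; rewrite -val_eqE /= inordK //; lia.
apply: (@not_facet_avoid ord0 v) => // [||q qP _|q qP _]; try exact: nt; first by left.
exact: internal_neq0.
Qed.

(** A path starting 0, i', j enters [j] from [i'], hence does not use the arc from [i] to [j]. *)
Lemma not_facet_pred i i' j : i = ord0 \/ internal i -> internal i' -> internal j ->
  i != i' -> i != j -> i' != j ->
  (forall q, inner q -> (i, j) \in arcs q -> gv q != bound) ->
  (forall q, inner q -> (ord0, i') \in arcs q -> (i', j) \in arcs q -> gv q != bound) ->
  ~ facet.
Proof.
move=> i_int i'_int j_int ii' ij i'j nt nt'.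
have [q1 q1P q1a] : exists2 q, inner q & (i, j) \in arcs q.
  case: i_int => [->|i_int].
    have [s sP] := inner_extend1 j_int.
    by exists (j :: s) => //=; rewrite inE eqxx.
  have [s sP] := inner_extend2 i_int j_int ij.
  by exists [:: i, j & s] => //=; rewrite !inE eqxx orbT.
have [s q2P] := inner_extend2 i'_int j_int i'j.
have q2a : (i', j) \in arcs [:: i', j & s] by rewrite /= !inE eqxx orbT.
apply: (@not_facet_of_arc i j _ _ _ (inner_ppath q1P) q1a (inner_ppath q2P)).
- by move=> t /ppath_inner [q qP ->]; exact: nt.
- apply/negP => q2a'; have e := arcs_pred_uniq (inner_uniq q2P) q2a q2a'.
  by rewrite e eqxx in ii'.
by apply: (nt' [:: i', j & s]) => //; rewrite /= inE eqxx.
Qed.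

(** The paths starting 0, x, y and 0, y, x are both non-tight, and only the first uses the arc from
    [x] to [y]. *)
Lemma not_facet_swap x y : internal x -> internal y -> x != y ->
  (forall q, inner q -> x \in q -> y \in q ->
     (x, y) \in arcs q \/ (y, x) \in arcs q -> gv q != bound) -> ~ facet.
Proof.
move=> x_int y_int xy nt; have [s1 q1P] := inner_extend2 x_int y_int xy.
have yx : y != x by rewrite eq_sym.
have [s2 q2P] := inner_extend2 y_int x_int yx.
have q1a : (x, y) \in arcs [:: x, y & s1] by rewrite /= !inE eqxx orbT.
apply: (@not_facet_of_arc x y _ _ _ (inner_ppath q1P) q1a (inner_ppath q2P)).
- move=> t /ppath_inner [q qP ->] xyq; apply: (nt q) => //; last by left.
    have := mem_arcs_tail xyq; rewrite belast_rcons inE => /orP[/eqP e|//].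
    by move: x_int; rewrite e /internal eqxx.
  exact: arcs_head_in xyq.
- apply/negP => q2a.
  have q2a0 : (ord0, y) \in arcs [:: y, x & s2] by rewrite /= inE eqxx.
  have e := arcs_pred_uniq (inner_uniq q2P) q2a0 q2a.
  by have := internal_neq0 x_int; rewrite e eqxx.
apply: (nt [:: y, x & s2]) => //; [by rewrite !inE eqxx orbT|by rewrite inE eqxx|right].
by rewrite /= !inE eqxx orbT.
Qed.

(** For even p + |R| a tight path visits all of R and has no bad arc. If R contains some [v], the
    arc from 0 to [v] is bad although [v] is always visited; if R is empty, any arc between two
    internal nodes of the same class is bad. *)
Lemma not_facet_even : ~~ odd (p + #|Rs|) -> ~ facet.
Proof.
move=> even_pr.
have [R0|[v vR]] := set_0Vmem Rs; last first.
  have v_int := internal_R vR; have v0 : ord0 != v by case/andP: v_int; rewrite eq_sym.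
  apply: (@not_facet_avoid ord0 v) => // [|q qP qa|q qP qv]; first by left.
    have vT := R_notT vR.
    have := badS_arc qa S0 vT; move: even_pr; by_counts qP.
  have /and3P[q_uniq _ _] := qP; have := cnt_ltn_card q_uniq vR qv.
  move: even_pr; by_counts qP.
(* Two of the nodes 1, 2, 3 agree on membership in S; all three are internal as n is at least 5. *)
have [x [y [x_int y_int xy xyS]]] : exists x y : 'I_n.+1,
    [/\ internal x, internal y, x != y & (x \in Ss) = (y \in Ss)].
  pose z k : 'I_n.+1 := inord k.
  have z_int k : (0 < k < 4)%N -> internal (z k).
    by move=> k14; apply/andP; split; rewrite -val_eqE /= inordK; lia.
  have z_neq k l : (k < 4)%N -> (l < 4)%N -> k != l -> z k != z l.
    by move=> k4 l4 kl; rewrite -val_eqE /= !inordK //; lia.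
  case: (boolP ((z 1 \in Ss) == (z 2 \in Ss))) => [/eqP e|e12].
    by exists (z 1), (z 2); rewrite !z_int ?z_neq.
  case: (boolP ((z 1 \in Ss) == (z 3 \in Ss))) => [/eqP e|e13].
    by exists (z 1), (z 3); rewrite !z_int ?z_neq.
  exists (z 2), (z 3); rewrite !z_int ?z_neq //; split=> //.
  by move: e12 e13; do 3!case: (_ \in Ss).
apply: (not_facet_swap x_int y_int xy) => q qP _ _ q_arc.
have : (0 < nbadS q + nbadT q)%N.
  have notR z : z \notin Rs by rewrite R0 inE.
  case: (boolP (x \in Ss)) => xS.
    have yS : y \in Ss by rewrite -xyS.
    by rewrite ltn_addr //; case: q_arc => /badS_arc; apply => //; exact: S_notT.
  have yS : y \notin Ss by rewrite -xyS.
  by rewrite ltn_addl //; case: q_arc => /badT_arc; apply => //; exact: notRS_T.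
move: even_pr; by_counts qP.
Qed.

(** A path has only p-1 inner nodes, so twice its value is at most 2p-1, whereas the bound is at
    least [p]. *)
Lemma not_facet_large_R : (p < #|Rs|)%N -> ~ facet.
Proof.
move=> pR; apply: not_facet_none => q qP.
move: pR; by_counts qP.
Qed.

Lemma exists_S_internal : (2 < #|Ss|)%N -> exists2 w, w \in Ss & internal w.
Proof.
move=> S3; have /card_gt0P [w] : (0 < #|Ss :\: [set ord0; ord_max]|)%N.
  rewrite cardsDS; first by rewrite cards2; case: (_ == _); lia.
  by apply/subsetP => x; rewrite !inE => /orP[] /eqP ->.
by rewrite !inE negb_or => /andP[w_int wS]; exists w.
Qed.

Lemma card_classes : (#|Rs| + #|Ss| + #|Ts| = n.+1)%N.
Proof.
rewrite -!sum1_card ![(\sum_(i in _) 1)%N]big_mkcond -!big_split /=.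
rewrite (eq_bigr (fun=> 1%N)) ?sum1_card ?card_ord // => i _.
by have := part i; do 3!case: (_ \in _).
Qed.

(** A tight path through an internal node outside R misses an R-node and so has no bad arc. If T is
    empty, the arc leaving 0 is always bad; otherwise every arc from R to [t1] is bad. *)
Lemma not_facet_pred_R : #|Rs| = p.-1 -> ~ facet.
Proof.
move=> Rp; have /card_gt1P [v [v' [vR v'R vv']]] : (1 < #|Rs|)%N by lia.
have v_int := internal_R vR; have v'_int := internal_R v'R.
have [T0|[t1 t1T]] := set_0Vmem Ts.
  have [|w wS w_int] := exists_S_internal.
    by have := card_classes; rewrite T0 cards0; lia.
  have vw : v != w by apply: contraTneq wS => <-; exact: R_notS.
  apply: (@not_facet_pred ord0 v w) => //; try exact: internal_neq0; first by left.
    move=> q qP qa; have wq := arcs_head_in w_int qa.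
    have wT : w \notin Ts by rewrite T0 inE.
    have := badS_arc qa S0 wT; have := cnt_gt0 wq wS.
    move: Rp; by_counts qP.
  move=> q qP qa0 qa; have wq := arcs_head_in w_int qa.
  have vT : v \notin Ts by rewrite T0 inE.
  have := badS_arc qa0 S0 vT; have := cnt_gt0 wq wS.
  move: Rp; by_counts qP.
have t1_int := internal_T t1T.
have Rt x : x \in Rs -> x != t1.
  by move=> xR; apply: contraTneq xR => ->; exact: T_notR.
have nt q u : inner q -> u \in Rs -> (u, t1) \in arcs q -> gv q != bound.
  move=> qP uR qa; have := badT_arc qa (R_notS uR) t1T.
  have := cnt_gt0 (arcs_head_in t1_int qa) t1T.
  move: Rp; by_counts qP.
apply: (@not_facet_pred v v' t1) => //; rewrite ?Rt //; first by right.
  by move=> q qP; exact: nt.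
by move=> q qP _; exact: nt.
Qed.

(** By [gval_badS] and parity a tight path must visit all of R and all of S, without an arc from S
    to a node outside T. So an internal node outside T is always visited but never entered from
    0. *)
Lemma not_facet_small_S : odd (p + #|Rs|) -> (#|Rs| + 3 <= p)%N ->
  (2 * #|Ss| + #|Rs| <= p + 2)%N -> ~ facet.
Proof.
move=> odd_pr Rp Sp.
have [|allT] := boolP [exists x, internal x && (x \notin Ts)].
  case/existsP=> x /andP[x_int xT].
  apply: (@not_facet_avoid ord0 x) => //; try exact: internal_neq0; first by left.
    move=> q qP qa; have := badS_arc qa S0 xT.
    move: odd_pr Rp Sp; by_counts qP.
  move=> q qP xq; have /and3P[q_uniq q_int _] := qP.
  case: (boolP (x \in Rs)) => xR.
    have := cnt_ltn_card q_uniq xR xq.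
    move: odd_pr Rp Sp; by_counts qP.
  have xS := notRT_S xR xT.
  have : (cnt Ss (x :: q) + 2 <= #|Ss|)%N.
    by apply: cnt_S_leq => //=; rewrite ?xq ?x_int.
  rewrite cnt_cons xS; move: odd_pr Rp Sp; by_counts qP.
apply: not_facet_none => q qP; have /and3P[_ /allP q_int /eqP q_size] := qP.
have : cnt Ts q = p.-1.
  rewrite -q_size.
  apply/eqP; rewrite /cnt -all_count; apply/allP => x xq.
  by have /existsPn /(_ x) := allT; rewrite q_int // negbK.
move: odd_pr Rp Sp; by_counts qP.
Qed.

(** By [gval_badT] and parity a tight path must visit all of R and T and enter T only from S, so [v]
    is always visited but never entered from [x]. Without such an [x], R is empty and T has a single
    node, and no path is tight. *)
Lemma not_facet_small_T : odd (p + #|Rs|) -> (#|Rs| + 3 <= p)%N ->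
  (2 * #|Ts| + #|Rs| <= p)%N -> ~ facet.
Proof.
move=> odd_pr Rp Tp; have [T0|[v vT]] := set_0Vmem Ts.
  apply: not_facet_none => q qP; have T0' : #|Ts| = 0%N by rewrite T0 cards0.
  move: T0' odd_pr Rp Tp; by_counts qP.
have v_int := internal_T vT.
have [|allS] := boolP [exists x, [&& internal x, x \notin Ss & x != v]].
  case/existsP=> x /and3P[x_int xS xv].
  apply: (@not_facet_avoid x v) => //; first by right.
    move=> q qP qa; have := badT_arc qa xS vT.
    move: odd_pr Rp Tp; by_counts qP.
  move=> q qP vq; have /and3P[q_uniq _ _] := qP.
  have := cnt_ltn_card q_uniq vT vq.
  move: odd_pr Rp Tp; by_counts qP.
have only_v x : internal x -> x \notin Ss -> x = v.
  by move=> x_int xS; have /existsPn /(_ x) := allS; rewrite x_int xS negbK => /eqP.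
have R0 : #|Rs| = 0%N.
  apply: eq_card0 => x; apply/negbTE/negP => xR.
  have xv : x = v by apply: only_v; [exact: internal_R|exact: R_notS].
  by have := R_notT xR; rewrite xv vT.
have T1 : (#|Ts| <= 1)%N.
  rewrite -(cards1 v); apply/subset_leq_card/subsetP => x xT; rewrite inE.
  by apply/eqP/only_v; [exact: internal_T|exact: T_notS].
apply: not_facet_none => q qP; move: R0 T1 Rp; by_counts qP.
Qed.

(** An arc between two internal S-nodes is already the single bad arc allowed. The path then visits
    all of R and, by its length, no T-node, and [gval_badT] leaves a value of at most |R|, below the
    bound |R| + 1. *)
Lemma not_facet_large_S : p = (#|Rs| + 3)%N -> (3 < #|Ss|)%N -> ~ facet.
Proof.
move=> pR S4.
have /card_gt1P [w [w' [wS' w'S' ww']]] : (1 < #|Ss :\: [set ord0; ord_max]|)%N.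
  rewrite cardsDS; first by rewrite cards2; case: (_ == _); lia.
  by apply/subsetP => x; rewrite !inE => /orP[] /eqP ->.
move: wS' w'S'; rewrite !inE !negb_or => /andP[w_int wS] /andP[w'_int w'S].
apply: (@not_facet_swap w w') => // q qP wq w'q q_arc.
have BS : (0 < nbadS q)%N.
  by case: q_arc => /badS_arc; apply; rewrite ?S_notT.
have S2 : (2 <= cnt Ss q)%N.
  rewrite /cnt -size_filter; apply: (@uniq_leq_size _ [:: w; w']); first by rewrite /= inE ww'.
  by move=> x; rewrite !inE mem_filter => /orP[] /eqP ->; rewrite ?wq ?w'q ?andbT.
move: pR BS S2; by_counts qP.
Qed.

Lemma not_facet_p4 : p = 4%N -> #|Rs| = 1%N -> #|Ss| = 3%N -> (1 < #|Ts|)%N -> ~ facet.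
Proof.
move=> p4 R1 S3 /card_gt1P [t [t' [tT t'T tt']]].
have /card_gt0P [v vR] : (0 < #|Rs|)%N by rewrite R1.
have [|w wS w_int] := exists_S_internal; first by rewrite S3.
have v_int := internal_R vR; have t_int := internal_T tT; have t'_int := internal_T t'T.
(* Since [v] and [w] are the only internal nodes of their classes, the form [f] below depends only
   on the classes of the nodes of a path. *)
have eqv x : (x == v) = (x \in Rs).
  have /cards1P [v' Rv'] : #|Rs| == 1%N by rewrite R1.
  by move: vR; rewrite Rv' !inE => /eqP ->.
have eqw x : internal x -> (x == w) = (x \in Ss).
  move=> x_int; apply/eqP/idP => [-> //|xS]; apply/eqP; apply: contraT => xw.
  have : (cnt Ss [:: x; w] + 2 <= #|Ss|)%N.
    by apply: cnt_S_leq => /=; rewrite ?inE ?xw ?x_int ?w_int.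
  by rewrite !cnt_cons xS wS S3.
have eq0 x : internal x -> (x == ord0) = false by case/andP => /negPf.
have eqm x : internal x -> (x == ord_max) = false by case/andP => _ /negPf.
have b2 : bound = 2%N by rewrite /bound p4 R1.
have [tR tS] := (T_notR tT, T_notS tT); have [t'R t'S] := (T_notR t'T, T_notS t'T).
have [vS vT] := (R_notS vR, R_notT vR); have [wR wT] := (S_notR wS, S_notT wS).
pose f i j : F := ((i == ord0) && (j == v))%:R + ((i == w) && (j == ord_max))%:R
                  - ((i == v) && (j == w))%:R.
have neq x y (X : {set 'I_n.+1}) : x \in X -> y \notin X -> x != y.
  by move=> xX; apply: contraNneq => <-.
have vt := neq _ _ _ vR tR; have vt' := neq _ _ _ vR t'R.
have wv := neq _ _ _ wS vS; have wt := neq _ _ _ wS tS.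
(* Both paths have slack 1, but [f] takes the value 1 on the first and 0 on the second, so [f] is no
   multiple of the slack. *)
have q1P : inner [:: v; t; t'].
  by rewrite /inner /= !inE negb_or p4 v_int t_int t'_int tt' vt vt'.
have q2P : inner [:: w; v; t].
  by rewrite /inner /= !inE negb_or p4 v_int t_int w_int wv wt vt.
have g1 : gv [:: v; t; t'] = 1%N.
  rewrite /gv /gval /gcoef /= vR (negPf tR) (negPf tS) (negPf t'R) (negPf t'S) (negPf vT).
  by rewrite (negPf (S_notR S0)) andbF.
have g2 : gv [:: w; v; t] = 1%N.
  rewrite /gv /gval /gcoef /= vR (negPf tR) (negPf tS) (negPf wR) (negPf wT) (negPf vT).
  by rewrite (negPf (S_notR S0)) !andbF.
have q1_nt : gv [:: v; t; t'] != bound by rewrite g1 b2.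
move=> /(gmc_facet (inner_ppath q1P) q1_nt) /(_ f) [t0|lam lamE].
  case/ppath_inner => q qP -> /=; rewrite -/(gv q) b2.
  have /and3P[q_uniq q_int q_size] := qP; rewrite p4 /= in q_size.
  case: q q_size q_uniq q_int {qP} => [|x1 [|x2 [|x3 []]]] //= _.
  rewrite !inE negb_or !andbT => /andP[/andP[x12 x13] x23] /and3P[i1 i2 i3].
  have uniqR x y : x != y -> (x \in Rs) && (y \in Rs) = false.
    by move=> xy; rewrite -!eqv; apply: contraNF xy => /andP[/eqP -> /eqP ->].
  have uniqS x y : internal x -> internal y -> x != y -> (x \in Ss) && (y \in Ss) = false.
    by move=> xi yi xy; rewrite -!eqw //; apply: contraNF xy => /andP[/eqP -> /eqP ->].
  rewrite /f /gv /gval /gcoef /= !eqxx !eqv (eqw x1) // (eqw x2) // (eqw x3) // !eq0 // !eqm //.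
  rewrite ![_ == w]eq_sym (eq0 w) // (eqm w) // S0 (negPf (S_notR S0)) (negPf (S_notT Sn)).
  move: (uniqR _ _ x12) (uniqR _ _ x13) (uniqR _ _ x23).
  move: (uniqS _ _ i1 i2 x12) (uniqS _ _ i1 i3 x13) (uniqS _ _ i2 i3 x23).
  move: (part x1) (part x2) (part x3).
  (* The class patterns of the three inner nodes are enumerated, with at most one node in R and at
     most one in S. *)
  case: (x1 \in Rs); case: (x1 \in Ss); case: (x1 \in Ts) => //= _;
  case: (x2 \in Rs); case: (x2 \in Ss); case: (x2 \in Ts) => //= _;
  case: (x3 \in Rs); case: (x3 \in Ss); case: (x3 \in Ts) => //= _ _ _ _ _ _ _ _;
  by rewrite !(addr0, add0r, subr0, sub0r, subrr, addNr).
have := lamE _ (inner_ppath q1P); have := lamE _ (inner_ppath q2P).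
rewrite -!/(gv _) g1 g2 b2 /f /= !eqxx !eqv (negPf tR) (negPf t'R) (negPf wR) (negPf (S_notR S0)).
rewrite !eq0 // !eqm // (eqw v) // (eqw t) // (eqw t') // ![_ == w]eq_sym (eq0 w) // (eqm w) //.
rewrite (negPf tS) (negPf t'S) (negPf vS) ?andbF /=; lra.
Qed.

Lemma card_S_rcons : (#|Ss :\ ord_max|).+1 = #|Ss|.
Proof. by rewrite (cardsD1 ord_max Ss) Sn. Qed.

Lemma facet_necessary : facet ->
  [/\ odd (p + #|Rs|),
      (p < 2 * #|Ss :\ ord_max| + #|Rs|)%N,
      (p < 2 * #|Ts| + #|Rs|)%N &
      ((p == #|Rs| + 3)%N && (2 <= #|Rs|)%N && (#|Ss| == 3)%N
       || (#|Rs| + 5 <= p)%N)].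
Proof.
move=> fac.
have odd_pr : odd (p + #|Rs|) by apply: contraT => /not_facet_even.
have Rp : (#|Rs| + 3 <= p)%N.
  have h1 : (#|Rs| <= p)%N by rewrite leqNgt; apply/negP => /not_facet_large_R.
  have h2 : (#|Rs| != p.-1)%N by apply/negP => /eqP /not_facet_pred_R.
  (* Parity also excludes |R| = p and |R| = p-2. *)
  by move: odd_pr h1 h2 p_ge4; clear; lia.
have Sp : (p < 2 * #|Ss :\ ord_max| + #|Rs|)%N.
  rewrite ltnNge; apply/negP => h; case: (not_facet_small_S odd_pr Rp) => //.
  by move: h card_S_rcons; clear; lia.
have Tp : (p < 2 * #|Ts| + #|Rs|)%N.
  by rewrite ltnNge; apply/negP => h; case: (not_facet_small_T odd_pr Rp h).
split=> //; rewrite orbC; case: (boolP (#|Rs| + 5 <= p)%N) => // Rp5; rewrite orFb.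
have pR : p = (#|Rs| + 3)%N.
  by move: odd_pr bound_double Rp Rp5; clear; lia.
have S3 : #|Ss| = 3%N.
  have h : (#|Ss| <= 3)%N by rewrite leqNgt; apply/negP => /(not_facet_large_S pR).
  by move: h Sp card_S_rcons pR; clear; lia.
rewrite S3 eqxx andbT -pR eqxx andTb ltnNge; apply/negP => R1.
(* With |R| at most 1 and [p] at least 4, the equation p = |R| + 3 leaves only p = 4 and |R| = 1. *)
case: not_facet_p4 => //; move: R1 Tp p_ge4 pR; clear; lia.
Qed.

(** * Sufficiency *)

(** The numbers are the labels used by [fragment]. *)
Definition cls (x : 'I_n.+1) : nat := if x \in Rs then 0 else if x \in Ss then 1 else 2.

Lemma cls_R x : (cls x == 0%N) = (x \in Rs).
Proof. by rewrite /cls; case: (x \in Rs) => //; case: (x \in Ss). Qed.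

Lemma cls_S x : (cls x == 1%N) = (x \in Ss).
Proof.
rewrite /cls; case: ifP => [xR|_]; last by case: (x \in Ss).
by rewrite (negPf (R_notS xR)).
Qed.

Lemma cls_T x : (cls x == 2%N) = (x \in Ts).
Proof.
rewrite /cls; case: ifP => [xR|/negbT xR]; first by rewrite (negPf (R_notT xR)).
case: ifP => [xS|/negbT xS]; first by rewrite (negPf (S_notT xS)).
by rewrite (notRS_T xR xS).
Qed.

Lemma nsum_cls x s : nsum gcoef x s = nsum glab (cls x) (map cls s).
Proof. by rewrite nsum_map; apply: eq_nsum => i j; rewrite /glab cls_R cls_S cls_T. Qed.

Lemma exists_fresh (X : {set 'I_n.+1}) U : (cnt X U < #|X|)%N ->
  exists2 x, x \in X & x \notin U.
Proof.
move=> XU; have [/existsP [x /andP[xX xU]]|noX] := boolP [exists x, (x \in X) && (x \notin U)].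
  by exists x.
suff : (#|X| <= cnt X U)%N by rewrite leqNgt XU.
rewrite /cnt -size_filter cardE; apply: uniq_leq_size; first exact: enum_uniq.
move=> x; rewrite mem_enum mem_filter => xX; rewrite /= xX.
by have /existsPn /(_ x) := noX; rewrite xX /= negbK.
Qed.

(** Every arc leaving an R-node counts one, and no arc of the chain enters T, so [x] contributes
    only if it lies in R. *)
Lemma nsum_R_list x y L Y : all [in Rs] L -> y \notin Ts ->
  nsum gcoef x (L ++ y :: Y) = ((x \in Rs) + size L + nsum gcoef y Y)%N.
Proof.
move=> LR yT; elim: L x LR => [|z L IH] x /=.
  by move=> _; rewrite addn0 /gcoef (negPf yT) andbF orbF.
case/andP=> zR LR; rewrite IH // zR /gcoef (negPf (R_notT zR)) andbF orbF.
exact: addnA.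
Qed.

(* The filler consists of [k] fresh S-T pairs followed by all R-nodes outside [U]. *)
Lemma exists_filler U k : uniq U -> all (@internal n) U ->
  (k + cnt Ss U + 2 <= #|Ss|)%N -> (k + cnt Ts U <= #|Ts|)%N ->
  exists Z : seq 'I_n.+1, [/\ uniq (U ++ Z), all (@internal n) Z, (size Z + cnt Rs U = 2 * k + #|Rs|)%N
    & forall x y Y, y \notin Ts ->
      (nsum gcoef x (Z ++ y :: Y) + cnt Rs U = (x \in Rs) + k + #|Rs| + nsum gcoef y Y)%N].
Proof.
elim: k U => [|k IH] U U_uniq U_int kS kT.
  pose Z := enum (Rs :\: [set x in U]).
  have ZR : all [in Rs] Z by apply/allP => x; rewrite mem_enum !inE => /andP[].
  have Z_size : (size Z + cnt Rs U = #|Rs|)%N.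
    rewrite -cardE addnC -(cardsID [set x in U] Rs); congr (_ + _)%N.
    rewrite /cnt -size_filter -(card_uniqP (filter_uniq _ U_uniq)).
    by apply: eq_card => x; rewrite !inE mem_filter.
  exists Z; split=> //.
  - rewrite cat_uniq U_uniq enum_uniq andbT /=; apply/hasPn => x.
    by rewrite mem_enum !inE => /andP[].
  - by apply: sub_all ZR => x; exact: internal_R.
  by move=> x y Y yT; rewrite nsum_R_list // addn0 -Z_size; clear; lia.
have [|w wS wU] := @exists_fresh Ss [:: ord0, ord_max & U].
  by rewrite !cnt_cons S0 Sn; move: kS; clear; lia.
have [|t tT tU] := @exists_fresh Ts U; first by move: kT; clear; lia.
have w_int : internal w by move: wU; rewrite !inE !negb_or => /and3P[w0 wm _]; apply/andP.
have {}wU : w \notin U by move: wU; rewrite !inE !negb_or => /and3P[].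
have wt : w != t by apply: contraTneq wS => ->; exact: T_notS.
have [||||Z [Z_uniq Z_int Z_size Zg]] := IH [:: w, t & U].
- by rewrite /= inE negb_or wt wU tU.
- by rewrite /= w_int internal_T.
- by rewrite !cnt_cons wS (negPf (T_notS tT)); move: kS; clear; lia.
- by rewrite !cnt_cons tT (negPf (S_notT wS)); move: kT; clear; lia.
have UR : cnt Rs [:: w, t & U] = cnt Rs U.
  by rewrite !cnt_cons (negPf (S_notR wS)) (negPf (T_notR tT)).
rewrite UR in Z_size Zg; exists [:: w, t & Z]; split.
- by rewrite -[[:: w, t & Z]]/([:: w; t] ++ Z) (perm_uniq (permEl (perm_catCA _ _ _))).
- by rewrite /= w_int internal_T.
- by rewrite -[size _]/(size Z).+2; move: Z_size; clear; lia.
move=> x y Y yT; have := Zg t y Y yT; rewrite (negPf (T_notR tT)).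
rewrite -[nsum _ x _]/(gcoef x w + (gcoef w t + nsum gcoef t (Z ++ y :: Y)))%N.
rewrite {3 4}/gcoef wS tT (negPf (S_notT wS)) andbF orbF orbT; clear; lia.
Qed.

(** * Completion and exchange of fragments *)

Section Fragments.
(** The p-1 inner nodes are [k] filler pairs, a fragment accounting for 2 [e] nodes and as many
    R-nodes as R has altogether; a fragment that misses an R-node has another node in its place. *)
Variables (k e : nat).
Hypothesis pE : (p.-1 = 2 * k + 2 * e + #|Rs|)%N.
Hypothesis boundE : (bound = k + e + #|Rs|)%N.
Hypothesis S_large : (k + e + 2 <= #|Ss|)%N.
Hypothesis T_large : (k + e + 1 <= #|Ts|)%N.

(** The filler is chosen disjoint from all of [U], hence before the fragment: fragments over the
    same nodes receive the same completion. The bounds on [lab] leave enough nodes of S and T for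
    the [k] pairs. *)
Lemma tight_fragment U lab : map cls (ord0 :: U) = lab -> uniq U -> all (@internal n) U ->
  (count_mem 1 lab <= e.+1)%N -> (count_mem 2 lab <= e.+1)%N ->
  exists Z : seq 'I_n.+1, forall I J, fragment e lab I J ->
    let h := nth ord0 (ord0 :: U) in let q := map h I ++ Z ++ map h J in
    inner q /\ gv q = bound.
Proof.
move=> labE U_uniq U_int lab1 lab2.
have lab_cnt (X : {set 'I_n.+1}) b : (forall x, (cls x == b) = (x \in X)) ->
    count_mem b lab = cnt X (ord0 :: U).
  by move=> bX; rewrite -labE count_map; apply: eq_count => x /=; rewrite bX.
move: lab1 lab2; rewrite (lab_cnt Ss 1%N cls_S) (lab_cnt Ts 2%N cls_T) !cnt_cons S0.
rewrite (negPf (S_notT S0)) => U1 U2.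
have [||Z [UZ_uniq Z_int Z_size Zg]] := exists_filler (k := k) U_uniq U_int.
- by move: S_large U1; clear; lia.
- by move: T_large U2; clear; lia.
exists Z => I J /and5P[IJ_uniq IJ_lt].
rewrite (lab_cnt Rs 0%N cls_R) cnt_cons (negPf (S_notR S0)) add0n.
set h := nth ord0 _; set X := map h I; set Y := map h J.
(* The two default values agree, as [ord0] has label 1. *)
have lh (i : nat) : nth 1%N lab i = cls (h i).
  have c0 : cls ord0 = 1%N by apply/eqP; rewrite cls_S.
  rewrite -labE /h; case: (ltnP i (size (ord0 :: U))) => iU; first by rewrite (nth_map ord0).
  by rewrite !nth_default ?size_map.
have mapE L : map (nth 1%N lab) L = map cls (map h L).
  by rewrite -map_comp; exact: (eq_map lh).
rewrite !mapE -/X -/Y size_cat => Y_head /eqP XY_size /eqP XY_g.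
have hU (i : nat) : (0 < i < size lab)%N -> h i \in U.
  by rewrite -labE size_map /h; case: i => // i /=; exact: mem_nth.
have U0 : uniq (ord0 :: U).
  by rewrite /= U_uniq andbT; apply/negP => /(allP U_int); rewrite /internal eqxx.
have XYU x : x \in X ++ Y -> x \in U.
  by rewrite -map_cat => /mapP [i /(allP IJ_lt) /hU ? ->].
have XY_uniq : uniq (X ++ Y).
  rewrite -map_cat map_inj_in_uniq // => i j /(allP IJ_lt) iP /(allP IJ_lt) jP /eqP.
  move: iP jP; rewrite -labE size_map => /andP[_ iP] /andP[_ jP].
  by rewrite nth_uniq // => /eqP.
have q_uniq : uniq (X ++ Z ++ Y).
  rewrite (perm_uniq (_ : perm_eq _ ((X ++ Y) ++ Z))); last by rewrite -catA perm_cat2l perm_catC.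
  move: UZ_uniq; rewrite !cat_uniq U_uniq -cat_uniq XY_uniq /= => /andP[UZ ->].
  by rewrite andbT; apply: contra UZ => /hasP [x xZ xXY]; apply/hasP; exists x => //; exact: XYU.
have q_int : all (@internal n) (X ++ Z ++ Y).
  rewrite all_cat all_cat Z_int /= -all_cat; apply/allP => x /XYU; exact: (allP U_int).
split.
  rewrite /inner q_uniq q_int pE !andTb !size_cat !size_map; move: XY_size Z_size; clear.
  by move=> ? ?; apply/eqP; lia.
(* After the filler comes the first node of [Y], or node n if [Y] is empty; this matches the default
   label 1 in [fragment]. *)
have rY : rcons Y ord_max = head ord_max Y :: behead (rcons Y ord_max) by case: (Y).
have clsm : cls ord_max = 1%N by apply/eqP; rewrite cls_S.
have headE : head 1%N (map cls Y) = cls (head ord_max Y) by case: (Y) => //=; rewrite clsm.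
have yT : head ord_max Y \notin Ts by rewrite -cls_T -headE.
rewrite /gv /gval !rcons_cat -/X -/Y nsum_cat rY.
have := Zg (last ord0 X) _ (behead (rcons Y ord_max)) yT.
have c0 : cls ord0 = 1%N by apply/eqP; rewrite cls_S.
have gX : nsum glab 1 (map cls X) = nsum gcoef ord0 X by rewrite nsum_cls c0.
have lastE : (last 1%N (map cls X) == 0%N) = (last ord0 X \in Rs).
  by rewrite -c0 last_map cls_R.
have tailE : behead (rcons (map cls Y) 1%N) = map cls (behead (rcons Y ord_max)).
  by case: (Y) => // y Y'; rewrite [rcons _ _]/= [behead _]/= map_rcons clsm.
move: XY_g; rewrite gX lastE headE tailE -nsum_cls boundE.
by case: (_ \in Rs); clear; lia.
Qed.

Variables (c : 'I_n.+1 -> 'I_n.+1 -> F) (gam : F).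
Hypothesis c_tight : forall q, inner q -> gv q = bound -> wsum c ord0 (rcons q ord_max) = gam.

(** Both fragments end in the same node and are followed by the same filler, so the common rest of
    the two tight paths cancels. *)
Lemma exchange U lab I I' : map cls (ord0 :: U) = lab -> uniq U -> all (@internal n) U ->
  (count_mem 1 lab <= e.+1)%N -> (count_mem 2 lab <= e.+1)%N ->
  fragment e lab I [::] -> fragment e lab I' [::] -> last 0%N I = last 0%N I' ->
  let a (i j : nat) := c (nth ord0 (ord0 :: U) i) (nth ord0 (ord0 :: U) j) in
  wsum a 0%N I = wsum a 0%N I'.
Proof.
move=> labE U_uniq U_int lab1 lab2 fI fI' lastI.
have [Z ZP] := tight_fragment labE U_uniq U_int lab1 lab2.
set h := nth ord0 (ord0 :: U) => a.
have sumE L : fragment e lab L [::] ->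
    wsum a 0%N L + wsum c (h (last 0%N L)) (rcons Z ord_max) = gam.
  move=> /ZP [qP qb]; rewrite -(c_tight qP qb) cats0 rcons_cat wsum_cat.
  by rewrite (last_map h L 0%N) (wsum_map h c 0%N).
by apply: (addIr (wsum c (h (last 0%N I)) (rcons Z ord_max))); rewrite sumE // lastI sumE.
Qed.

Lemma exists_tight_last U lab I J x : map cls (ord0 :: U) = lab -> uniq U ->
  all (@internal n) U -> (count_mem 1 lab <= e.+1)%N -> (count_mem 2 lab <= e.+1)%N ->
  fragment e lab I J -> J != [::] -> nth ord0 (ord0 :: U) (last 0%N J) = x ->
  exists q, [/\ inner q, gv q = bound & last ord0 q = x].
Proof.
move=> labE U_uniq U_int lab1 lab2 fIJ J0 <-.
have [Z /(_ _ _ fIJ) /= [qP qb]] := tight_fragment labE U_uniq U_int lab1 lab2.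
eexists; split; [exact: qP|exact: qb|rewrite catA last_cat].
by case: J J0 {fIJ qP qb} => // j J _; rewrite /= last_map.
Qed.

(** A tight path now carries weight on its last arc only. Since every internal node can be last, all
    arcs into n have weight [gam], and the arc from [t0] shows that [gam] is zero. *)
Lemma zero_arcs_to_max (t0 : 'I_n.+1) : internal t0 -> c t0 ord_max = 0 ->
  (forall i j, arcb n (i, j) -> j != ord_max -> c i j = 0) ->
  (forall x, internal x -> exists q, [/\ inner q, gv q = bound & last ord0 q = x]) ->
  forall i j, arcb n (i, j) -> c i j = 0.
Proof.
move=> t0_int ct0 c0 lastP.
have cE x : internal x -> c x ord_max = gam.
  case/lastP => q [qP qb <-]; rewrite -(c_tight qP qb) -cats1 wsum_cat /= addr0.
  have /and4P[_ _ q_path _] := inner_ppath qP; have /and3P[_ q_int _] := qP.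
  suff -> : wsum c ord0 q = 0 by rewrite add0r.
  move: q_path; rewrite rcons_path => /andP[q_path _].
  elim: q ord0 q_int q_path {qP qb} => [//|y q IH] z /= /andP[/andP[_ ym] q_int] /andP[zy yq].
  by rewrite c0 // IH // addr0.
move=> i j ij; case: (eqVneq j ord_max) => [j_max|jm]; last exact: c0.
move: ij; rewrite j_max /arcb /= eqxx andbT => /and4P[im _ _ i0].
by rewrite cE ?/internal ?i0 // -(cE t0).
Qed.

End Fragments.

Lemma clsR x : x \in Rs -> cls x = 0%N.
Proof. by rewrite -cls_R => /eqP. Qed.

Lemma clsS x : x \in Ss -> cls x = 1%N.
Proof. by rewrite -cls_S => /eqP. Qed.

Lemma clsT x : x \in Ts -> cls x = 2%N.
Proof. by rewrite -cls_T => /eqP. Qed.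

Lemma neq_cls x y : cls x != cls y -> x != y.
Proof. by apply: contraNneq => ->. Qed.

Lemma internal_cases x : internal x -> [\/ x \in Rs, x \in Ss /\ internal x | x \in Ts].
Proof.
move=> x_int; case: (boolP (x \in Rs)) => xR; first by constructor 1.
case: (boolP (x \in Ss)) => xS; first by constructor 2.
by constructor 3; exact: notRS_T.
Qed.

Lemma arc_cases i j : arcb n (i, j) -> j != ord_max ->
  [/\ i = ord0 \/ internal i, internal j & i != j].
Proof.
case/and4P => /= ij j0 im _ jm; split=> //; last by apply/andP.
by case: (eqVneq i ord0) => i0; [left|right; apply/andP].
Qed.

(** * All arcs vanish when p is at least |R| + 5 *)

Section TwoExtraPairs.
Variables (k : nat).
Hypothesis pE : (p.-1 = 2 * k + 2 * 2 + #|Rs|)%N.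
Hypothesis boundE : (bound = k + 2 + #|Rs|)%N.
Hypothesis S_large : (k + 2 + 2 <= #|Ss|)%N.
Hypothesis T_large : (k + 2 + 1 <= #|Ts|)%N.
Variables (c : 'I_n.+1 -> 'I_n.+1 -> F) (gam : F).
Hypothesis c_tight : forall q, inner q -> gv q = bound -> wsum c ord0 (rcons q ord_max) = gam.
Variables (w0 t0 : 'I_n.+1).
Hypothesis w0S : w0 \in Ss.
Hypothesis w0_int : internal w0.
Hypothesis t0T : t0 \in Ts.
(** This and the next five hypotheses are the normalisation supplied by [exists_gauge], whose
    parameter [mu] is chosen to obtain [c0w0]. *)
Hypothesis c0t : forall t, t \in Ts -> c ord0 t = 0.
Hypothesis cwt0 : forall w, w \in Ss -> internal w -> c w t0 = 0.
Hypothesis ct0w0 : c t0 w0 = 0.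
Hypothesis c0w0 : c ord0 w0 = 0.
Hypothesis ct0v : forall v, v \in Rs -> c t0 v = 0.
Hypothesis ct0m : c t0 ord_max = 0.

Let SI w := (w \in Ss) && internal w.

Let fresh_S w : exists w', SI w' && (w != w').
Proof.
have [|w' w'S] := @exists_fresh Ss [:: ord0; ord_max; w].
  by rewrite !cnt_cons; move: S_large; do 3!case: (_ \in Ss); clear; rewrite /cnt /=; lia.
rewrite !inE !negb_or => /and3P[w0' wm ww]; exists w'.
by rewrite /SI w'S /internal w0' wm eq_sym.
Qed.

Let fresh_T t t' : exists t'', [&& t'' \in Ts, t != t'' & t' != t''].
Proof.
have [|t'' t''T] := @exists_fresh Ts [:: t; t'].
  by rewrite !cnt_cons; move: T_large; do 2!case: (_ \in Ts); clear; rewrite /cnt /=; lia.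
rewrite !inE !negb_or => /andP[tt t't]; exists t''.
by rewrite t''T eq_sym tt eq_sym t't.
Qed.

(** With node 0 in front these are the six nodes of [lin_zero_2]. *)
Let config w w' t t' t'' :=
  [&& SI w, SI w', w != w', t \in Ts, t' \in Ts, t'' \in Ts & uniq [:: t; t'; t'']].

Let configP w w' t t' t'' (U := [:: w; w'; t; t'; t'']) : config w w' t t' t'' ->
  [/\ map cls (ord0 :: U) = [:: 1; 1; 1; 2; 2; 2]%N, uniq U & all (@internal n) U].
Proof.
case/and5P=> /andP[wS w_int] /andP[w'S w'_int] ww' tT /and3P[t'T t''T T_uniq].
have ST x y : x \in Ss -> y \in Ts -> x != y.
  by move=> xS yT; apply: neq_cls; rewrite (clsS xS) (clsT yT).
split; first by rewrite /= (clsS S0) (clsS wS) (clsS w'S) (clsT tT) (clsT t'T) (clsT t''T).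
  by rewrite /= in T_uniq *; rewrite T_uniq !inE !negb_or ww' !ST.
by rewrite /= w_int w'_int !internal_T.
Qed.

(** Of the seven zero arcs required by [lin_zero_2], three come from [c0t] and four are assumed
    here. *)
Let local_zero w w' t t' t'' : config w w' t t' t'' ->
  c w t = 0 -> c w' t = 0 -> c t w = 0 -> c ord0 w = 0 ->
  forall x y, x \in [:: ord0; w; w'; t; t'; t''] -> y \in [:: w; w'; t; t'; t''] -> x != y ->
  c x y = 0.
Proof.
move=> cfg cwt cw't ctw c0w x y; have [labE U_uniq U_int] := configP cfg.
have /and5P[_ _ _ tT /and3P[t'T t''T _]] := cfg.
set L := ord0 :: _ => xL yL xy.
have H (i j : nat) : (i < 6)%N -> (0 < j < 6)%N -> i != j ->
    c (nth ord0 L i) (nth ord0 L j) = 0.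
  apply: (lin_zero_2 (a := fun i j : nat => c (nth ord0 L i) (nth ord0 L j)) _
    (c0t tT) (c0t t'T) (c0t t''T) cwt cw't ctw c0w).
  move=> I I' fI fI'.
  exact: (exchange pE boundE S_large T_large c_tight labE U_uniq U_int isT isT fI fI').
have yL' : y \in L by rewrite inE yL orbT.
have y0 : ord0 != y by apply: internal_neq0; exact: (allP U_int).
have := H (index x L) (index y L); rewrite !nth_index //; apply.
- by rewrite -[6%N]/(size L) index_mem.
- rewrite -[6%N]/(size L) index_mem yL' andbT lt0n; apply: contraNneq y0 => y0.
  by rewrite -(nth_index ord0 yL') y0.
by apply: contraNneq xy => ixy; rewrite -(nth_index ord0 xL) ixy nth_index.
Qed.

Let SI0 : SI w0. Proof. by rewrite /SI w0S. Qed.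

(** Any given nodes fit into a configuration through [w0] and [t0], where the normalisation provides
    the arcs required by [local_zero]. *)
Let config_of w t t' : SI w -> t \in Ts -> t' \in Ts -> exists w1 t1 t2,
  [/\ config w0 w1 t0 t1 t2, w \in [:: w0; w1], t \in [:: t0; t1; t2] & t' \in [:: t0; t1; t2]].
Proof.
move=> wSI tT t'T.
have [w1 [w1SI w01 ww]] : exists w1, [/\ SI w1, w0 != w1 & w \in [:: w0; w1]].
  case: (eqVneq w0 w) => [<-|w0w].
    by have [w1 /andP[? ?]] := fresh_S w0; exists w1; rewrite !inE eqxx.
  by exists w; rewrite !inE eqxx orbT.
have [t1 [t1T t01 tt]] : exists t1, [/\ t1 \in Ts, t0 != t1 & t \in [:: t0; t1]].
  case: (eqVneq t0 t) => [<-|t0t].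
    by have [t1 /and3P[? ? _]] := fresh_T t0 t0; exists t1; rewrite !inE eqxx.
  by exists t; rewrite !inE eqxx orbT.
have [t2 [t2T t02 t12 t't]] : exists t2, [/\ t2 \in Ts, t0 != t2, t1 != t2 &
    t' \in [:: t0; t1; t2]].
  case: (eqVneq t0 t') => [<-|t0t'].
    by have [t2 /and3P[? ? ?]] := fresh_T t0 t1; exists t2; rewrite !inE eqxx.
  case: (eqVneq t1 t') => [<-|t1t'].
    by have [t2 /and3P[? ? ?]] := fresh_T t0 t1; exists t2; rewrite !inE eqxx orbT.
  by exists t'; rewrite !inE eqxx !orbT.
exists w1, t1, t2; split=> //; last by move: tt; rewrite !inE => /orP[] ->; rewrite ?orbT.
by rewrite /config SI0 w1SI w01 t0T t1T t2T /= !inE negb_or t01 t02 t12.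
Qed.

Let zero_family w t t' x y : SI w -> t \in Ts -> t' \in Ts ->
  x \in [:: ord0; w; t; t'] -> y \in [:: w; t; t'] -> x != y -> c x y = 0.
Proof.
move=> wSI tT t'T xL yL; have [w1 [t1 [t2 [cfg wL tL t'L]]]] := config_of wSI tT t'T.
have /and3P[_ /andP[w1S w1_int] _] := cfg.
have sub z : z \in [:: w; t; t'] -> z \in [:: w0; w1; t0; t1; t2].
  rewrite -(cat1s w0) (mem_cat _ [:: w0; w1] [:: t0; t1; t2]).
  by rewrite 3!inE => /or3P[] /eqP ->; rewrite ?wL ?tL ?t'L ?orbT.
apply: (local_zero cfg) => //; try exact: cwt0; last exact: sub.
by move: xL; rewrite in_cons => /orP[/eqP ->|/sub xs]; rewrite in_cons ?eqxx // xs orbT.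
Qed.

Let c0w w : SI w -> c ord0 w = 0.
Proof.
move=> wSI; have /andP[_ w_int] := wSI.
by apply: (zero_family wSI t0T t0T); rewrite ?inE ?eqxx ?internal_neq0.
Qed.

Let cwt w t : SI w -> t \in Ts -> c w t = 0.
Proof.
move=> wSI tT; have /andP[wS _] := wSI; apply: (zero_family wSI tT tT); rewrite ?inE ?eqxx ?orbT //.
by apply: neq_cls; rewrite (clsS wS) (clsT tT).
Qed.

Let ctw w t : SI w -> t \in Ts -> c t w = 0.
Proof.
move=> wSI tT; have /andP[wS _] := wSI; apply: (zero_family wSI tT tT); rewrite ?inE ?eqxx ?orbT //.
by apply: neq_cls; rewrite (clsS wS) (clsT tT).
Qed.

Let ctt t t' : t \in Ts -> t' \in Ts -> t != t' -> c t t' = 0.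
Proof.
move=> tT t'T tt'; have w0SI : SI w0 by rewrite /SI w0S.
by apply: (zero_family w0SI tT t'T); rewrite ?inE ?eqxx ?orbT.
Qed.

(** Arcs between S and T vanish by now, so [local_zero] also applies to a configuration on an
    arbitrary pair of S-nodes. *)
Let cww w w' : SI w -> SI w' -> w != w' -> c w w' = 0.
Proof.
move=> wSI w'SI ww'; have [w1 [t1 [t2 [cfg _ _ _]]]] := config_of wSI t0T t0T.
have cfg' : config w w' t0 t1 t2.
  by move: cfg; rewrite /config wSI w'SI ww' => /and5P[_ _ _ -> ->].
apply: (local_zero cfg'); rewrite ?inE ?eqxx ?orbT //; first [exact: cwt|exact: ctw|exact: c0w].
Qed.

Let exists_config w w' t t' : SI w -> SI w' -> w != w' -> t \in Ts -> t' \in Ts -> t != t' ->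
  exists t'', config w w' t t' t''.
Proof.
move=> wSI w'SI ww' tT t'T tt'; have [t'' /and3P[t''T tt'' t't'']] := fresh_T t t'.
by exists t''; rewrite /config wSI w'SI ww' tT t'T t''T /= !inE negb_or tt' tt'' t't''.
Qed.

(** Four fragments through [v] are compared with t, w, t', w', t'', which misses [v]; all other arcs
    involved are already known to vanish. *)
Let R_relations w w' t t' t'' v : config w w' t t' t'' -> v \in Rs ->
  [/\ c t v + c v w = 0, c t' v + c v t'' = 0, c ord0 v + c v w = 0 & c w v + c v w' = 0].
Proof.
move=> cfg vR; have [labE U_uniq U_int] := configP cfg.
have /and5P[wSI w'SI _ tT /and3P[t'T t''T /and3P[]]] := cfg.
rewrite !inE negb_or => /andP[tt' tt''] t't'' _.
pose U := [:: v; w; w'; t; t'; t''].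
have lab' : map cls (ord0 :: U) = [:: 1; 0; 1; 1; 2; 2; 2]%N.
  by move: labE => /= [-> -> -> -> -> ->]; rewrite (clsR vR).
have U'_uniq : uniq U.
  rewrite [uniq U]cons_uniq U_uniq andbT; apply/negP => /(map_f cls); rewrite (clsR vR).
  by move: labE => /= [_ -> -> -> -> ->].
have U'_int : all (@internal n) U by rewrite /= internal_R.
have ex I I' := exchange pE boundE S_large T_large c_tight lab' U'_uniq U'_int isT isT (I := I) (I' := I').
have /= := ex [:: 4; 1; 2; 5; 6]%N [:: 4; 2; 5; 3; 6]%N isT isT erefl.
have /= := ex [:: 4; 2; 5; 1; 6]%N [:: 4; 2; 5; 3; 6]%N isT isT erefl.
have /= := ex [:: 1; 2; 4; 3; 6]%N [:: 4; 2; 5; 3; 6]%N isT isT erefl.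
have /= := ex [:: 4; 2; 1; 3; 6]%N [:: 4; 2; 5; 3; 6]%N isT isT erefl.
rewrite (c0t tT) (ctw wSI tT) (cwt wSI t'T) (ctw w'SI t'T) (cwt w'SI t''T).
rewrite (ctt t'T t''T t't'') (cwt wSI tT) (ctw w'SI tT) !(add0r, addr0).
by move=> ? ? ? ?; split.
Qed.

Let cvw v w : v \in Rs -> SI w -> c v w = 0.
Proof.
move=> vR wSI; have [w' /andP[w'SI ww']] := fresh_S w.
have [t' /and3P[t'T t0t' _]] := fresh_T t0 t0.
have [t'' cfg] := exists_config wSI w'SI ww' t0T t'T t0t'.
by have [+ _ _ _] := R_relations cfg vR; rewrite ct0v // add0r.
Qed.

Let R_zero v w t : v \in Rs -> SI w -> t \in Ts ->
  [/\ c t v = 0, c v t = 0, c ord0 v = 0 & c w v = 0].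
Proof.
move=> vR wSI tT; have [w' /andP[w'SI ww']] := fresh_S w.
have [t' /and3P[t'T tt' _]] := fresh_T t t.
have [t'' cfg] := exists_config wSI w'SI ww' tT t'T tt'.
have ctv x : x \in Ts -> c x v = 0.
  move=> xT; have [x' /and3P[x'T xx' _]] := fresh_T x x.
  have [x'' cfg'] := exists_config wSI w'SI ww' xT x'T xx'.
  by have [+ _ _ _] := R_relations cfg' vR; rewrite (cvw vR wSI) addr0.
have [_ _ + +] := R_relations cfg vR; rewrite (cvw vR wSI) (cvw vR w'SI) !addr0 => -> ->.
have /and5P[_ _ _ _ /and3P[_ t''T /= ]] := cfg; rewrite !inE negb_or => /and3P[/andP[_ tt''] t't'' _].
(* The T-nodes are rotated so that the second relation contains the arc from [v] to [t]. *)
have cfg2 : config w w' t' t'' t.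
  by rewrite /config wSI w'SI ww' t'T t''T tT /= !inE negb_or t't'' (eq_sym t') tt' eq_sym tt''.
have [_ + _ _] := R_relations cfg2 vR; rewrite !ctv // add0r => ->.
by split=> //; exact: ctv.
Qed.

(** In the comparison of t0, v, v', t1, w0, t2 with t0, v, t1, v', w0, t2 the arc from [v] to [v']
    is the only one not yet known to vanish. *)
Let cvv v v' : v \in Rs -> v' \in Rs -> v != v' -> c v v' = 0.
Proof.
move=> vR v'R vv'; have [w1 [t1 [t2 [cfg _ _ _]]]] := config_of SI0 t0T t0T.
have [labE U_uniq U_int] := configP cfg.
have /and5P[_ w1SI _ _ /and3P[t1T t2T /and3P[]]] := cfg.
rewrite !inE negb_or => /andP[t01 t02] t12 _.
pose U := [:: v; v'; w0; w1; t0; t1; t2].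
have lab' : map cls (ord0 :: U) = [:: 1; 0; 0; 1; 1; 2; 2; 2]%N.
  by move: labE => /= [-> -> -> -> -> ->]; rewrite (clsR vR) (clsR v'R).
have U'_uniq : uniq U.
  have notin u : u \in Rs -> u \notin [:: w0; w1; t0; t1; t2].
    by move=> uR; apply/negP => /(map_f cls); rewrite (clsR uR); move: labE => /= [_ -> -> -> -> ->].
  by rewrite [uniq U]cons_uniq cons_uniq U_uniq in_cons negb_or vv' !notin.
have U'_int : all (@internal n) U by rewrite /= (internal_R vR) (internal_R v'R).
have /= := exchange pE boundE S_large T_large c_tight lab' U'_uniq U'_int isT isT
  (I := [:: 5; 1; 2; 6; 3; 7]%N) (I' := [:: 5; 1; 6; 2; 3; 7]%N) isT isT erefl.
have [cv1 cv2 _ _] := R_zero vR SI0 t1T; have [cv'1 cv'2 _ _] := R_zero v'R SI0 t1T.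
rewrite (c0t t0T) (ct0v vR) (cwt SI0 t2T) (ctw SI0 t1T) cv2 cv'1 cv'2 (cvw v'R SI0).
by rewrite !(add0r, addr0).
Qed.

Let tight_last x : internal x -> exists q, [/\ inner q, gv q = bound & last ord0 q = x].
Proof.
case/internal_cases => [xR|[xS x_int]|xT].
- have [w1 [t1 [t2 [cfg _ _ _]]]] := config_of SI0 t0T t0T.
  have [labE U_uniq U_int] := configP cfg.
  pose U := [:: x; w0; w1; t0; t1; t2].
  have lab' : map cls (ord0 :: U) = [:: 1; 0; 1; 1; 2; 2; 2]%N.
    by move: labE => /= [-> -> -> -> -> ->]; rewrite (clsR xR).
  have U'_uniq : uniq U.
    rewrite [uniq U]cons_uniq U_uniq andbT; apply/negP => /(map_f cls); rewrite (clsR xR).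
    by move: labE => /= [_ -> -> -> -> ->].
  have U'_int : all (@internal n) U by rewrite /= internal_R.
  exact: (exists_tight_last pE boundE S_large T_large lab' U'_uniq U'_int isT isT
    (I := [:: 4; 2; 5; 6]%N) (J := [:: 1]%N)).
- have xSI : SI x by rewrite /SI xS.
  have [w' /andP[w'SI xw']] := fresh_S x; have [t1 /and3P[t1T t01 _]] := fresh_T t0 t0.
  have [t2 cfg] := exists_config xSI w'SI xw' t0T t1T t01.
  have [labE U_uniq U_int] := configP cfg.
  exact: (exists_tight_last pE boundE S_large T_large labE U_uniq U_int isT isT
    (I := [:: 3; 2; 4]%N) (J := [:: 1]%N)).
(* The part after the filler must not begin in T, so [x] is preceded by [w0]. *)
have [w' /andP[w'SI xw']] := fresh_S w0; have [t1 /and3P[t1T xt1 _]] := fresh_T x x.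
have [t2 cfg] := exists_config SI0 w'SI xw' xT t1T xt1.
have [labE U_uniq U_int] := configP cfg.
exact: (exists_tight_last pE boundE S_large T_large labE U_uniq U_int isT isT
  (I := [:: 4; 5]%N) (J := [:: 1; 3]%N)).
Qed.

Lemma gauged_zero_2 :
  (exists2 q, inner q & gv q = bound) /\ forall i j, arcb n (i, j) -> c i j = 0.
Proof.
split; first by have [q [? ? _]] := tight_last w0_int; exists q.
apply: (zero_arcs_to_max c_tight (internal_T t0T) ct0m) => // i j /arc_cases ij /ij.
case=> -[->|i_int] j_int {}ij.
  case: (internal_cases j_int) => [jR|[jS _]|jT]; last exact: c0t.
    by have [_ _ -> _] := R_zero jR SI0 t0T.
  by apply: c0w; rewrite /SI jS.
case: (internal_cases i_int) (internal_cases j_int) => [iR|[iS _]|iT] [jR|[jS _]|jT].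
- exact: cvv.
- by apply: cvw => //; rewrite /SI jS.
- by have [_ -> _ _] := R_zero iR SI0 jT.
- by have [|_ _ _ ->] := R_zero jR (w := i) _ t0T; rewrite // /SI iS.
- by apply: cww; rewrite // /SI ?iS ?jS.
- by apply: cwt; rewrite // /SI iS.
- by have [-> _ _ _] := R_zero jR SI0 iT.
- by apply: ctw; rewrite // /SI jS.
- exact: ctt.
Qed.

End TwoExtraPairs.

(** * All arcs vanish when p = |R| + 3 *)

Section OneExtraPair.
Hypothesis pE : (p.-1 = 2 * 0 + 2 * 1 + #|Rs|)%N.
Hypothesis boundE : (bound = 0 + 1 + #|Rs|)%N.
Hypothesis S_large : (0 + 1 + 2 <= #|Ss|)%N.
Hypothesis T_large : (0 + 1 + 1 <= #|Ts|)%N.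
Hypothesis R_large : (2 <= #|Rs|)%N.
Variables (c : 'I_n.+1 -> 'I_n.+1 -> F) (gam : F).
Hypothesis c_tight : forall q, inner q -> gv q = bound -> wsum c ord0 (rcons q ord_max) = gam.
Variables (w0 t0 v0 : 'I_n.+1).
Hypothesis w0S : w0 \in Ss.
Hypothesis w0_int : internal w0.
Hypothesis only_w0 : forall w, w \in Ss -> internal w -> w = w0.
Hypothesis t0T : t0 \in Ts.
Hypothesis v0R : v0 \in Rs.
Hypothesis c0t : forall t, t \in Ts -> c ord0 t = 0.
Hypothesis cw0t0 : c w0 t0 = 0.
Hypothesis ct0w0 : c t0 w0 = 0.
(** In this case the parameter [mu] of [exists_gauge] is spent on the arc from [v0] to [w0]; the arc
    from 0 to [w0] is shown to vanish in [c0w]. *)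
Hypothesis cv0w0 : c v0 w0 = 0.
Hypothesis ct0v : forall v, v \in Rs -> c t0 v = 0.
Hypothesis ct0m : c t0 ord_max = 0.

Let fresh (X : {set 'I_n.+1}) x : (2 <= #|X|)%N -> exists y, (y \in X) && (x != y).
Proof.
move=> X2; have [|y yX] := @exists_fresh X [:: x].
  by rewrite !cnt_cons; move: X2; case: (_ \in X); clear; rewrite /cnt /=; lia.
by rewrite inE => yx; exists y; rewrite yX eq_sym.
Qed.

(** S has a single internal node here, so two R-nodes join [w0] and two T-nodes to form the
    configuration of [lin_zero_1]. *)
Let config t t' u v := [&& t \in Ts, t' \in Ts, t != t', u \in Rs, v \in Rs & u != v].

Let configP t t' u v (U := [:: w0; t; t'; u; v]) : config t t' u v ->
  [/\ map cls (ord0 :: U) = [:: 1; 1; 2; 2; 0; 0]%N, uniq U & all (@internal n) U].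
Proof.
case/and5P=> tT t'T tt' uR /andP[vR uv].
have ST y : y \in Ts -> w0 != y.
  by move=> yT; apply: neq_cls; rewrite (clsS w0S) (clsT yT).
have SR y : y \in Rs -> w0 != y.
  by move=> yR; apply: neq_cls; rewrite (clsS w0S) (clsR yR).
have TR x y : x \in Ts -> y \in Rs -> x != y.
  by move=> xT yR; apply: neq_cls; rewrite (clsT xT) (clsR yR).
split; first by rewrite /= (clsS S0) (clsS w0S) (clsT tT) (clsT t'T) (clsR uR) (clsR vR).
  rewrite /= !inE !negb_or tt' uv (ST _ tT) (ST _ t'T) (SR _ uR) (SR _ vR).
  by rewrite (TR _ _ tT uR) (TR _ _ tT vR) (TR _ _ t'T uR) (TR _ _ t'T vR).
by rewrite /= w0_int (internal_T tT) (internal_T t'T) (internal_R uR) (internal_R vR).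
Qed.

Let local_zero t t' u v : config t t' u v ->
  c w0 t = 0 -> c t u = 0 -> c t v = 0 -> c t w0 = 0 -> c u w0 = 0 ->
  forall x y, x \in [:: ord0; w0; t; t'; u; v] -> y \in [:: w0; t; t'; u; v] -> x != y ->
  c x y = 0.
Proof.
move=> cfg cwt ctu ctv ctw cuw x y; have [labE U_uniq U_int] := configP cfg.
have /and5P[tT t'T _ _ _] := cfg.
set L := ord0 :: _ => xL yL xy.
have H (i j : nat) : (i < 6)%N -> (0 < j < 6)%N -> i != j ->
    c (nth ord0 L i) (nth ord0 L j) = 0.
  apply: (lin_zero_1 (a := fun i j : nat => c (nth ord0 L i) (nth ord0 L j)) _
    (c0t tT) (c0t t'T) cwt ctu ctv ctw cuw).
  move=> I I' fI fI'.
  exact: (exchange pE boundE S_large T_large c_tight labE U_uniq U_int isT isT fI fI').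
have yL' : y \in L by rewrite inE yL orbT.
have y0 : ord0 != y by apply: internal_neq0; exact: (allP U_int).
have := H (index x L) (index y L); rewrite !nth_index //; apply.
- by rewrite -[6%N]/(size L) index_mem.
- rewrite -[6%N]/(size L) index_mem yL' andbT lt0n; apply: contraNneq y0 => y0.
  by rewrite -(nth_index ord0 yL') y0.
by apply: contraNneq xy => ixy; rewrite -(nth_index ord0 xL) ixy nth_index.
Qed.

Let config_of t v : t \in Ts -> v \in Rs -> exists t1 v1,
  [/\ config t0 t1 v0 v1, t \in [:: t0; t1] & v \in [:: v0; v1]].
Proof.
move=> tT vR.
have [t1 [t1T t01 tt]] : exists t1, [/\ t1 \in Ts, t0 != t1 & t \in [:: t0; t1]].
  case: (eqVneq t0 t) => [<-|t0t]; last by exists t; rewrite !inE eqxx orbT.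
  by have [t1 /andP[? ?]] := fresh t0 T_large; exists t1; rewrite !inE eqxx.
have [v1 [v1R v01 vv]] : exists v1, [/\ v1 \in Rs, v0 != v1 & v \in [:: v0; v1]].
  case: (eqVneq v0 v) => [<-|v0v]; last by exists v; rewrite !inE eqxx orbT.
  by have [v1 /andP[? ?]] := fresh v0 R_large; exists v1; rewrite !inE eqxx.
by exists t1, v1; rewrite /config t0T t1T t01 v0R v1R v01.
Qed.

Let zero_family t v x y : t \in Ts -> v \in Rs ->
  x \in [:: ord0; w0; t; v] -> y \in [:: w0; t; v] -> x != y -> c x y = 0.
Proof.
move=> tT vR xL yL; have [t1 [v1 [cfg tL vL]]] := config_of tT vR.
have /and5P[_ _ _ _ /andP[v1R _]] := cfg.
have sub z : z \in [:: w0; t; v] -> z \in [:: w0; t0; t1; v0; v1].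
  rewrite [in X in _ -> X]in_cons (mem_cat _ [:: t0; t1] [:: v0; v1]).
  by rewrite 3!inE => /or3P[] /eqP ->; rewrite ?tL ?vL ?eqxx ?orbT.
apply: (local_zero cfg) => //; try exact: ct0v; last exact: sub.
by move: xL; rewrite in_cons => /orP[/eqP ->|/sub xs]; rewrite in_cons ?eqxx // xs orbT.
Qed.

Let neqTR t v : t \in Ts -> v \in Rs -> t != v.
Proof. by move=> tT vR; apply: neq_cls; rewrite (clsT tT) (clsR vR). Qed.

Let neqST t : t \in Ts -> w0 != t.
Proof. by move=> tT; apply: neq_cls; rewrite (clsT tT) (clsS w0S). Qed.

Let neqSR v : v \in Rs -> w0 != v.
Proof. by move=> vR; apply: neq_cls; rewrite (clsR vR) (clsS w0S). Qed.

Let c0w : c ord0 w0 = 0.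
Proof. by apply: (zero_family t0T v0R); rewrite ?inE ?eqxx ?internal_neq0. Qed.

Let c0v v : v \in Rs -> c ord0 v = 0.
Proof.
by move=> vR; apply: (zero_family t0T vR); rewrite ?inE ?eqxx ?orbT ?internal_neq0 ?internal_R.
Qed.

Let cwt t : t \in Ts -> c w0 t = 0.
Proof. by move=> tT; apply: (zero_family tT v0R); rewrite ?inE ?eqxx ?orbT ?neqST. Qed.

Let ctw t : t \in Ts -> c t w0 = 0.
Proof. by move=> tT; apply: (zero_family tT v0R); rewrite ?inE ?eqxx ?orbT // eq_sym neqST. Qed.

Let cwv v : v \in Rs -> c w0 v = 0.
Proof. by move=> vR; apply: (zero_family t0T vR); rewrite ?inE ?eqxx ?orbT ?neqSR. Qed.

Let cvw v : v \in Rs -> c v w0 = 0.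
Proof. by move=> vR; apply: (zero_family t0T vR); rewrite ?inE ?eqxx ?orbT // eq_sym neqSR. Qed.

Let ctv t v : t \in Ts -> v \in Rs -> c t v = 0.
Proof. by move=> tT vR; apply: (zero_family tT vR); rewrite ?inE ?eqxx ?orbT ?neqTR. Qed.

Let cvt t v : t \in Ts -> v \in Rs -> c v t = 0.
Proof. by move=> tT vR; apply: (zero_family tT vR); rewrite ?inE ?eqxx ?orbT // eq_sym neqTR. Qed.

Let exists_config t t' u v : t \in Ts -> t' \in Ts -> t != t' -> u \in Rs -> v \in Rs -> u != v ->
  config t t' u v.
Proof. by rewrite /config => -> -> -> -> -> ->. Qed.

(** The arcs required by [local_zero] are now known to vanish for every T-node, so [t] takes the
    place of [t0]. *)
Let ctt t t' : t \in Ts -> t' \in Ts -> t != t' -> c t t' = 0.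
Proof.
move=> tT t'T tt'; have [v1 /andP[v1R v01]] := fresh v0 R_large.
apply: (local_zero (exists_config tT t'T tt' v0R v1R v01)); rewrite ?inE ?eqxx ?orbT //;
  first [exact: cwt|exact: ctv|exact: ctw].
Qed.

Let cvv v v' : v \in Rs -> v' \in Rs -> v != v' -> c v v' = 0.
Proof.
move=> vR v'R vv'; have [t1 /andP[t1T t01]] := fresh t0 T_large.
apply: (local_zero (exists_config t0T t1T t01 vR v'R vv')); rewrite ?inE ?eqxx ?orbT //;
  first [exact: ct0v|exact: cvw].
Qed.

Let tight_last x : internal x -> exists q, [/\ inner q, gv q = bound & last ord0 q = x].
Proof.
have [t1 /andP[t1T t01]] := fresh t0 T_large; have [v1 /andP[v1R v01]] := fresh v0 R_large.
case/internal_cases => [xR|[xS x_int]|xT].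
- have [v /andP[vR xv]] := fresh x R_large.
  have vx : v != x by rewrite eq_sym.
  have [labE U_uniq U_int] := configP (exists_config t0T t1T t01 vR xR vx).
  exact: (exists_tight_last pE boundE S_large T_large labE U_uniq U_int isT isT
    (I := [:: 2; 3; 4]%N) (J := [:: 5]%N)).
- have [labE U_uniq U_int] := configP (exists_config t0T t1T t01 v0R v1R v01).
  rewrite (only_w0 xS x_int).
  exact: (exists_tight_last pE boundE S_large T_large labE U_uniq U_int isT isT
    (I := [:: 2; 4; 5]%N) (J := [:: 1]%N)).
have [t /andP[tT xt]] := fresh x T_large.
have [labE U_uniq U_int] := configP (exists_config xT tT xt v0R v1R v01).
exact: (exists_tight_last pE boundE S_large T_large labE U_uniq U_int isT isT
  (I := [:: 3; 4]%N) (J := [:: 5; 2]%N)).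
Qed.

Lemma gauged_zero_1 :
  (exists2 q, inner q & gv q = bound) /\ forall i j, arcb n (i, j) -> c i j = 0.
Proof.
split; first by have [q [? ? _]] := tight_last w0_int; exists q.
apply: (zero_arcs_to_max c_tight (internal_T t0T) ct0m) => // i j /arc_cases ij /ij.
case=> -[->|i_int] j_int {}ij.
  case: (internal_cases j_int) => [jR|[jS _]|jT]; [exact: c0v| |exact: c0t].
  by rewrite (only_w0 jS j_int) c0w.
move: ij; case: (internal_cases i_int) => [iR|[iS _]|iT];
  case: (internal_cases j_int) => [jR|[jS _]|jT];
  rewrite ?(only_w0 iS i_int) ?(only_w0 jS j_int) => ij.
- exact: cvv.
- exact: cvw.
- exact: cvt.
- exact: cwv.
- by rewrite eqxx in ij.
- exact: cwt.
- exact: ctv.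
- exact: ctw.
- exact: ctt.
Qed.

End OneExtraPair.

(* The linear form [c] is normalised modulo the forms [u_i - u_j + mu + lam g_ij], which are
   constant on the tight paths; [lam] is determined by requiring [t0 w0] to have weight zero. *)
Lemma exists_gauge (c : 'I_n.+1 -> 'I_n.+1 -> F) w0 t0 (mu : F) :
  w0 \in Ss -> internal w0 -> t0 \in Ts ->
  exists (u : 'I_n.+1 -> F) (lam : F),
  let c' i j := c i j - (u i - u j + mu + lam * (gcoef i j)%:R) in
  [/\ forall t, t \in Ts -> c' ord0 t = 0,
      forall w, w \in Ss -> internal w -> c' w t0 = 0,
      c' t0 w0 = 0,
      forall v, v \in Rs -> c' t0 v = 0 & c' t0 ord_max = 0] /\
  c' ord0 w0 = c ord0 w0 + c w0 t0 - c ord0 t0 - mu /\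
  forall v, v \in Rs ->
    c' v w0 = c v w0 + c t0 v + c w0 t0 - (c t0 w0 + c w0 t0) *+ 2 + mu.
Proof.
move=> w0S w0_int t0T; pose lam := c t0 w0 + c w0 t0 - mu *+ 2.
pose ut := mu + lam - c ord0 t0.
(* Each value solves one normalising equation: T-nodes through the arc from 0, R-nodes and n through
   the arc from [t0], internal S-nodes through the arc to [t0]. The parameter [mu] remains free. *)
pose u x := if x == ord0 then 0 else if x \in Ts then mu + lam - c ord0 x
  else if (x \in Rs) || (x == ord_max) then ut + mu - c t0 x else c x t0 - c ord0 t0.
have u0 : u ord0 = 0 by rewrite /u eqxx.
have uT t : t \in Ts -> u t = mu + lam - c ord0 t.
  by move=> tT; rewrite /u tT; have /andP[/negPf -> _] := internal_T tT.
have uS w : w \in Ss -> internal w -> u w = c w t0 - c ord0 t0.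
  move=> wS /andP[w0' wm].
  by rewrite /u (negPf w0') (negPf (S_notT wS)) (negPf (S_notR wS)) (negPf wm).
have uR v : v \in Rs -> u v = ut + mu - c t0 v.
  move=> vR; have /andP[/negPf v0 _] := internal_R vR.
  by rewrite /u v0 (negPf (R_notT vR)) vR.
have um : u ord_max = ut + mu - c t0 ord_max.
  by rewrite /u eqxx orbT (negPf (S_notT Sn)) eq_sym (negPf (ord0_neq_max n_gt0)).
have gT i : gcoef t0 i = 0%N by rewrite /gcoef (negPf (T_notR t0T)) (negPf (T_notS t0T)).
have gST w t : w \in Ss -> t \in Ts -> gcoef w t = 1%N.
  by move=> wS tT; rewrite /gcoef wS tT orbT.
have gSS w w' : w \in Ss -> w' \in Ss -> gcoef w w' = 0%N.
  by move=> wS w'S; rewrite /gcoef (negPf (S_notR wS)) (negPf (S_notT w'S)) andbF.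
exists u, lam; split; last split.
- split=> [t tT|w wS w_int||v vR|].
  + by rewrite u0 (uT t) // gST //; lra.
  + by rewrite (uS w) // (uT t0) // gST //; lra.
  + by rewrite (uS w0) // (uT t0) // gT /lam; lra.
  + by rewrite (uR v) // (uT t0) // gT /ut; lra.
  by rewrite um (uT t0) // gT /ut; lra.
- by rewrite u0 (uS w0) // gSS //; lra.
move=> v vR; rewrite (uR v) // (uS w0) // /gcoef vR /= /ut /lam; lra.
Qed.

(** On paths a form of the given shape is a constant plus [lam] times the value, because the
    potential telescopes and the length is fixed. A tight path shows the constant to be [- lam]
    times the bound. *)
Lemma facet_of_gauge :
  (exists w t t', [/\ w \in Ss, internal w, t \in Ts, t' \in Ts & t != t']) ->
  odd (p + #|Rs|) ->
  (forall c, (forall q, inner q -> gv q = bound -> wsum c ord0 (rcons q ord_max) = 0) ->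
     exists (u : 'I_n.+1 -> F) (mu lam : F), (exists2 q, inner q & gv q = bound) /\
       forall i j, arcb n (i, j) -> c i j = u i - u j + mu + lam * (gcoef i j)%:R) ->
  facet.
Proof.
move=> [w [t [t' [wS w_int tT t'T tt']]]] odd_pr gauge.
(* A path starting 0, w, t, t' has the two bad arcs from 0 to [w] and from [t] to [t'], hence is not
   tight. *)
have [||||s [q0P _]] := @inner_extend [:: w; t; t'] ord0.
- have wT x : x \in Ts -> w != x.
    by move=> xT; apply: neq_cls; rewrite (clsS wS) (clsT xT).
  by rewrite /= !inE negb_or tt' !wT.
- by rewrite /= w_int (internal_T tT) (internal_T t'T).
- exact: p_ge4.
- rewrite !inE !negb_or (internal_neq0 w_int) (internal_neq0 (internal_T tT)).
  exact: (internal_neq0 (internal_T t'T)).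
set q0 := _ ++ s in q0P.
have q0_nt : gv q0 != bound.
  have a1 : (ord0, w) \in arcs q0 by rewrite /= !inE eqxx.
  have a2 : (t, t') \in arcs q0 by rewrite /= !inE eqxx !orbT.
  have := badS_arc a1 S0 (S_notT wS); have := badT_arc a2 (T_notS tT) t'T.
  by move: odd_pr; by_counts q0P.
apply/(gmc_facet (inner_ppath q0P) q0_nt) => c c0.
have [|u [mu [lam [[q1 q1P q1b] cE]]]] := gauge c.
  by move=> q qP qb; apply: c0 => //; exact: inner_ppath.
have sumE t0 : ppath n p t0 ->
    wsum c ord0 t0 = u ord0 - u ord_max + p%:R * mu + lam * (gval t0)%:R.
  move=> t0P; have /and4P[/eqP t_size _ t_path /eqP t_last] := t0P.
  rewrite (eq_wsum_path cE t_path) wsumD wsumD wsum_potential wsum_const wsumZ wsum_nat.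
  by rewrite t_size t_last.
exists (- lam) => t0 t0P; rewrite (sumE _ t0P).
have := c0 _ (inner_ppath q1P) q1b; rewrite (sumE _ (inner_ppath q1P)) -/(gv q1) q1b => /eqP.
rewrite addr_eq0 => /eqP ->.
by rewrite mulNr mulrBr opprB addrC.
Qed.

Lemma facet_sufficient :
  odd (p + #|Rs|) -> (p < 2 * #|Ss :\ ord_max| + #|Rs|)%N -> (p < 2 * #|Ts| + #|Rs|)%N ->
  ((p == #|Rs| + 3)%N && (2 <= #|Rs|)%N && (#|Ss| == 3)%N || (#|Rs| + 5 <= p)%N) ->
  facet.
Proof.
move=> odd_pr Sp Tp cases; have b2 := bound_double; have S1 := card_S_rcons.
have [|w0 w0S w0_int] := exists_S_internal.
  by move: cases Sp S1 p_ge4; clear; lia.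
have /card_gt1P [t0 [t1 [t0T t1T t01]]] : (1 < #|Ts|)%N.
  by move: cases Tp p_ge4; clear; lia.
apply: facet_of_gauge => //; first by exists w0, t0, t1.
move=> c c0.
(* The normalised form is still constant on the tight paths; this constant is the [gam] of the two
   cases. *)
have tightE (u : 'I_n.+1 -> F) mu lam q : inner q -> gv q = bound ->
    wsum (fun i j => c i j - (u i - u j + mu + lam * (gcoef i j)%:R)) ord0 (rcons q ord_max) =
    - (u ord0 - u ord_max + p%:R * mu + lam * bound%:R).
  move=> qP qb; have /and4P[/eqP t_size _ _ _] := inner_ppath qP.
  have wsumN f x s : wsum (fun i j => - f i j) x s = - wsum f x s :> F.
    by elim: s x => [|y s IH] x /=; rewrite ?oppr0 // IH opprD.
  rewrite wsumD wsumN wsumD wsumD wsum_potential wsum_const wsumZ wsum_nat c0 // t_size.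
  by rewrite last_rcons -/(gval _) -/(gv q) qb add0r.
have done u mu lam : ((exists2 q, inner q & gv q = bound) /\ forall i j, arcb n (i, j) ->
      c i j - (u i - u j + mu + lam * (gcoef i j)%:R) = 0) ->
    exists (u : 'I_n.+1 -> F) (mu lam : F), (exists2 q, inner q & gv q = bound) /\
       forall i j, arcb n (i, j) -> c i j = u i - u j + mu + lam * (gcoef i j)%:R.
  by case=> ex H; exists u, mu, lam; split=> // i j /H /eqP; rewrite subr_eq0 => /eqP.
case: (boolP (#|Rs| + 5 <= p)%N) cases => [Rp _|Rp];
  last rewrite orbF => /andP[/andP[/eqP pR R2] /eqP S3].
  have [k kE] : exists k, p = (2 * k + 5 + #|Rs|)%N.
    (* The witness solves [bound = k + 2 + #|Rs|]. *)
    by exists (bound - #|Rs| - 2)%N; move: odd_pr b2 Rp; clear; lia.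
  (* This [mu] makes the normalised weight of the arc from 0 to [w0] vanish. *)
  have [u [lam [[g1 g2 g3 g4 g5] [g6 _]]]] :=
    exists_gauge c (c ord0 w0 + c w0 t0 - c ord0 t0) w0S w0_int t0T.
  apply: (done u _ lam); apply: (@gauged_zero_2 k _ _ _ _ _ _ (tightE u _ lam) _ _ w0S w0_int t0T
    g1 g2 g3 (etrans g6 (subrr _)) g4 g5).
  - by move: kE; clear; lia.
  - by move: kE odd_pr b2; clear; lia.
  - by move: kE Sp S1; clear; lia.
  - by move: kE Tp; clear; lia.
have /card_gt0P [v0 v0R] : (0 < #|Rs|)%N by move: R2; clear; lia.
(* This [mu] makes the normalised weight of the arc from [v0] to [w0] vanish. *)
have [u [lam [[g1 g2 g3 g4 g5] [_ g6]]]] := exists_gauge c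
  (- (c v0 w0 + c t0 v0 + c w0 t0 - (c t0 w0 + c w0 t0) *+ 2)) w0S w0_int t0T.
apply: (done u _ lam); apply: (@gauged_zero_1 _ _ _ _ R2 _ _ (tightE u _ lam) _ _ _ w0S w0_int _ t0T v0R
  g1 (g2 _ w0S w0_int) g3 (etrans (g6 _ v0R) (subrr _)) g4 g5).
- by move: pR; clear; lia.
- by move: pR odd_pr b2; clear; lia.
- by move: S3; clear; lia.
- by move: pR Tp; clear; lia.
move=> w wS w_int; apply/eqP; apply: contraT => ww0.
have : (cnt Ss [:: w; w0] + 2 <= #|Ss|)%N.
  by apply: cnt_S_leq => /=; rewrite ?inE ?ww0 ?w_int ?w0_int.
by rewrite !cnt_cons wS w0S S3.
Qed.

End Facet.

End GeneralizedMaxCut.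

Theorem theorem15 (F : realFieldType) (n p : nat) (Rs Ss Ts : {set 'I_n.+1}) :
  (0 < n)%N -> (4 <= p)%N -> (p <= n - 1)%N ->
  [disjoint Rs & Ss] -> [disjoint Rs & Ts] -> [disjoint Ss & Ts] ->
  Rs :|: Ss :|: Ts = [set: 'I_n.+1] ->
  ord0 \in Ss -> ord_max \in Ss ->
  valid_ineq (Ppath F n p) (gmc_lhs Rs Ss Ts) ((p + #|Rs|)./2)%:R /\
  (facet_defining (Ppath F n p) (gmc_lhs Rs Ss Ts) ((p + #|Rs|)./2)%:R <->
   [/\ odd (p + #|Rs|),
       (p < 2 * #|Ss :\ ord_max| + #|Rs|)%N,
       (p < 2 * #|Ts| + #|Rs|)%N &
       ((p == #|Rs| + 3)%N && (2 <= #|Rs|)%N && (#|Ss| == 3)%N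
        || (#|Rs| + 5 <= p)%N)]).
Proof.
move=> _ p_ge4 p_le RS RT ST cover S0 Sn.
have part x : ((x \in Rs) + (x \in Ss) + (x \in Ts) = 1)%N.
  have : x \in Rs :|: Ss :|: Ts by rewrite cover inE.
  rewrite !inE; case: (boolP (x \in Rs)) => xR.
    by rewrite (disjointFr RS xR) (disjointFr RT xR).
  by case: (boolP (x \in Ss)) => xS; [rewrite (disjointFr ST xS)|move=> /= ->].
split; first exact: gmc_valid.
split; first exact: facet_necessary.
by case=> *; apply: facet_sufficient.
Qed.
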